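(* Let $A$ be a finite dimensional basic algebra over a field $K$. Let $(U,Q)$ be a basic $\tau$-rigid pair in $\mathsf{mod}\,A$, let $\mathcal W:=U^\bot\cap{}^\bot(\tau U)\cap Q^\bot$ be the associated wide subcategory of $\mathsf{mod}\,A$, and let $(M,P)$ be a basic $\tau$-tilting pair in $\mathsf{mod}\,A$. Then the following statements hold. (i) $\mathcal W\cap \mathsf{Fac}\,M$ is a torsion class in $\mathcal W$, and $\mathsf{Fac}\,U\ast(\mathcal W\cap\mathsf{Fac}\,M)$ is a torsion class in $\mathsf{tors}_{(U,Q)}(A)$. (ii) Any $W\in\mathcal W$ has a left $(U^\bot\cap \mathsf{Fac}\,M)$-approximation. (iii) The following conditions are equivalent: (a) $U^\bot\cap\mathsf{Fac}\,M=\mathcal W\cap \mathsf{Fac}\,M$; (b) $U^\bot\cap\mathsf{Fac}\,M\subseteq\mathcal W$; (c) $U^\bot\cap\mathsf{Fac}\,M\subseteq{}^\bot(\tau U)\cap Q^\bot$; (d) $\mathsf{Fac}\,M\subseteq{}^\bot(\tau U)\cap Q^\bot$. Suppose now in addition that $\mathsf{Fac}\,M\subseteq{}^\bot(\tau U)\cap Q^\bot$. Then moreover: (iv) $\mathcal W\cap \mathsf{Fac}\,M$ is a functorially finite torsion class in $\mathcal W$, and $\mathsf{Fac}\,U\ast(\mathcal W\cap\mathsf{Fac}\,M)$ is a functorially finite torsion class in $\mathsf{ftors}_{(U,Q)}(A)$. (v) The left Bongartz completion $B^-_{(U,Q)}(M,P)$ of $(U,Q)$ with respect to $(M,P)$ exists,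 and $$\mathsf{Fac}\,U\ast(\mathcal W\cap \mathsf{Fac}\,M)=\mathsf{Fac}\,U\ast(U^\bot\cap\mathsf{Fac}\,M)=\mathsf{Fac}\,U\ast\mathsf{Fac}\,M.$$
   Context: $\mathsf{mod}\,A$ is the category of finitely generated right $A$-modules and $\tau$ is the Auslander–Reiten translation in $\mathsf{mod}\,A$. All subcategories are full and closed under isomorphisms. For a subcategory (or object) $\mathcal X$ of $\mathsf{mod}\,A$: $\mathcal X^\bot=\{C\mid \mathrm{Hom}_A(\mathcal X,C)=0\}$, ${}^\bot\mathcal X=\{C\mid \mathrm{Hom}_A(C,\mathcal X)=0\}$; $\mathsf{add}\,\mathcal X$ is the additive closure; $\mathsf{Fac}\,\mathcal X$ consists of the factor modules of modules in $\mathsf{add}\,\mathcal X$. $|M|$ is the number of non-isomorphic indecomposable direct summands of $M$. A pair $(M,P)$ with $M\in\mathsf{mod}\,A$ and $P$ a projective module is $\tau$-rigid if $\mathrm{Hom}_A(M,\tau M)=0$ and $\mathrm{Hom}_A(P,M)=0$; a $\tau$-rigid pair is $\tau$-tilting if $|M|+|P|=|A|$. It is basic if both $M$ and $P$ are basic. Pairs are considered up to isomorphism. $(U,Q)$ is a direct summand of $(M,P)$ if there is a $\tau$-rigid pair $(U',Q')$ with $M\cong U\oplus U'$, $P\cong Q\oplus Q'$. Let $\mathcal C$ be a category and $\mathcal X\subseteq\mathcal C$ a subcategory. A left $\mathcal X$-approximation of $C\in\mathcal C$ is a morphism $f:C\to X$ with $X\in\mathcal X$ such that every morphism $C\to X'$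 with $X'\in\mathcal X$ factors through $f$; right approximations are dual. $\mathcal X$ is functorially finite in $\mathcal C$ if every object of $\mathcal C$ has both a left and a right $\mathcal X$-approximation. A wide subcategory of $\mathsf{mod}\,A$ is one closed under kernels, cokernels and extensions (hence abelian); it is known that $\mathcal W$ is wide. In an abelian category $\mathcal A$ (here $\mathsf{mod}\,A$ or $\mathcal W$), a torsion pair is a pair $(\mathcal T,\mathcal F)$ of subcategories with $\mathrm{Hom}_{\mathcal A}(\mathcal T,\mathcal F)=0$ and such that every $X\in\mathcal A$ has a short exact sequence $0\to X_t\to X\to X_f\to0$ with $X_t\in\mathcal T$, $X_f\in\mathcal F$; $\mathcal T$ is then called a torsion class. A functorially finite torsion class is a torsion class that is a functorially finite subcategory of $\mathcal A$. $\mathsf{tors}_{(U,Q)}(A)$ (resp. $\mathsf{ftors}_{(U,Q)}(A)$) is the set of torsion classes (resp. functorially finite torsion classes) $\mathcal T$ in $\mathsf{mod}\,A$ with $\mathsf{Fac}\,U\subseteq\mathcal T\subseteq{}^\bot(\tau U)\cap Q^\bot$. For subcategories $\mathcal X,\mathcal Y$ of $\mathsf{mod}\,A$, $\mathcal X\ast\mathcal Y$ is the subcategory of modules $N$ admitting a short exact sequence $0\to X\to N\to Y\to 0$ with $X\in\mathcal X$, $Y\in\mathcal Y$. Known (Adachi–Iyama–Reiten): $(M,P)\mapsto\mathsf{Fac}\,M$ is a bijection from (isomorphism classes of) basic $\tau$-tilting pairs to functorially finite torsion classes in $\mathsf{mod}\,A$, and $(U,Q)$ is a direct summand of the basic $\tau$-tilting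 pair corresponding to $\mathcal T$ if and only if $\mathcal T\in\mathsf{ftors}_{(U,Q)}(A)$. Definition: if $\mathsf{Fac}\,U\ast(\mathcal W\cap\mathsf{Fac}\,M)$ is in $\mathsf{ftors}_{(U,Q)}(A)$, the basic $\tau$-tilting pair corresponding to it under this bijection is called the left Bongartz completion of $(U,Q)$ with respect to $(M,P)$ and denoted $B^-_{(U,Q)}(M,P)$; in this case the completion is said to exist. *)

(* Defs.v *)
From HB Require Import structures.
From mathcomp Require Import all_boot all_algebra falgebra.
From mathcomp Require Import boolp.

Set Implicit Arguments.
Unset Strict Implicit.
Unset Printing Implicit Defensive.

Import GRing.Theory.
Local Open Scope ring_scope.
Local Open Scope lfun_scope.

(* Objects of mod A.  As A is finite dimensional over K, a right A-module is  *)
(* finitely generated iff it is finite dimensional over K, so the carrier is  *)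
(* a vectType.  [ract M a] is x |-> x a; since \o composes from right to      *)
(* left, a right action reverses products.                                    *)
Record rmod (K : fieldType) (A : falgType K) := RMod {
  rmod_car :> vectType K;
  ract : A -> 'End(rmod_car);
  ract_linear : linear ract;
  ract1 : ract 1 = \1;
  ractM : forall a b, ract (a * b) = ract b \o ract a
}.
Arguments ract {K A} r a.
Arguments RMod {K A} rmod_car ract.

Section Homomorphisms.
Variables (K : fieldType) (A : falgType K).
Implicit Types M N L : rmod A.

Definition ract_lin M : {linear A -> 'End(M)} :=
  HB.pack (ract M) (GRing.isSemilinear.Build K A 'End(M) _ (ract M)
    (GRing.semilinear_linear (@ract_linear K A M))).

(* A-linearity is tested on a K-basis of A so that Hom_A(M, N) is a vspace;   *)
(* rhom_spaceP is the usual description.                                      *)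
Definition rcomm M N (f : 'Hom(M, N)) :
    {ffun 'I_(\dim {:A}) -> 'Hom(M, N)} :=
  [ffun i : 'I__ => (f \o ract M (vbasis {:A})`_i)
                    - (ract N (vbasis {:A})`_i \o f)].

Fact rcomm_is_linear M N : linear (@rcomm M N).
Proof.
move=> c f g; apply/ffunP => i; rewrite !ffunE.
rewrite comp_lfunDl -comp_lfunZl comp_lfunDr -comp_lfunZr.
by rewrite scalerBr opprD addrACA.
Qed.

HB.instance Definition _ M N := GRing.isSemilinear.Build K _ _ _
  (@rcomm M N) (GRing.semilinear_linear (@rcomm_is_linear M N)).

Definition rhom_space M N : {vspace 'Hom(M, N)} := lker (linfun (@rcomm M N)).

Lemma rhom_spaceP M N (f : 'Hom(M, N)) :
  reflect (forall a x, f (ract M a x) = ract N a (f x)) (f \in rhom_space M N).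
Proof.
rewrite memv_ker lfunE /=; apply: (iffP eqP) => [f0 a x | fA]; last first.
  apply/ffunP => i; rewrite !ffunE; apply/lfunP => x.
  by rewrite add_lfunE opp_lfunE !comp_lfunE fA subrr zero_lfunE.
have fb (i : 'I_(\dim {:A})) : f (ract M (vbasis {:A})`_i x)
                             = ract N (vbasis {:A})`_i (f x).
  move/ffunP/(_ i): f0; rewrite !ffunE /= => /subr0_eq /lfunP/(_ x).
  by rewrite !comp_lfunE.
rewrite -[ract M]/(ract_lin M : A -> _) -[ract N]/(ract_lin N : A -> _).
rewrite (coord_vbasis (memvf a)) !linear_sum !sum_lfunE linear_sum.
by apply: eq_bigr => i _; rewrite !linearZ !scale_lfunE linearZ /= fb.
Qed.

Definition rhom M N : predArgType := subvs_of (rhom_space M N).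
Definition rhom_lfun M N (f : rhom M N) : 'Hom(M, N) := vsval f.
Coercion rhom_lfun : rhom >-> hom.

Lemma rhomA M N (f : rhom M N) a x : f (ract M a x) = ract N a (f x).
Proof. exact: (rhom_spaceP (vsval f) (subvsP f)). Qed.

Fact rhom_comp_subproof L M N (g : rhom M N) (f : rhom L M) :
  (g : 'Hom(M, N)) \o f \in rhom_space L N.
Proof. by apply/rhom_spaceP => a x; rewrite !comp_lfunE !rhomA. Qed.
Definition rhom_comp L M N (g : rhom M N) (f : rhom L M) : rhom L N :=
  Subvs (rhom_comp_subproof g f).

Lemma rhom_compE L M N (g : rhom M N) (f : rhom L M) x :
  rhom_comp g f x = g (f x).
Proof. exact: comp_lfunE. Qed.

Lemma rhomP M N (f g : rhom M N) : (forall x, f x = g x) -> f = g.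
Proof. by move=> fg; apply: val_inj; apply/lfunP. Qed.

Lemma rhomDZE M N c (f g : rhom M N) x :
  rhom_lfun (c *: f + g) x = c *: f x + g x.
Proof. by rewrite /rhom_lfun linearP /= add_lfunE scale_lfunE. Qed.

Definition rmono M N (f : rhom M N) := lker f = 0%VS.
Definition repi M N (f : rhom M N) := limg f = fullv.
Definition riso M N := exists f : rhom M N, rmono f /\ repi f.

Definition short_exact L M N (f : rhom L M) (g : rhom M N) :=
  [/\ rmono f, limg f = lker g & repi g].

Definition submodule M (U : {vspace M}) := forall a, (ract M a @: U <= U)%VS.

End Homomorphisms.

Section Constructions.
Variables (K : fieldType) (A : falgType K).
Implicit Types M N : rmod A.

Definition rmod_regular : rmod A.
Proof.
refine (@RMod K A A (@amulr K A) (@amulr_is_linear K A) _ _).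
- by apply/lfunP => x; rewrite lfunE /= mulr1 id_lfunE.
- by move=> a b; apply/lfunP => x; rewrite comp_lfunE !lfunE /= mulrA.
Defined.

Definition rmod0 : rmod A.
Proof.
refine (@RMod K A 'rV[K]_0 (fun _ => \1) _ _ _).
- by move=> c a b; apply/lfunP => x; apply/rowP => -[].
- by [].
- by move=> a b; rewrite comp_lfun1l.
Defined.

Definition dsum_act M N (a : A) (x : M * N) : M * N :=
  (ract M a x.1, ract N a x.2).
Fact dsum_act_is_linear M N a : linear (@dsum_act M N a).
Proof.
by move=> c [x1 x2] [y1 y2]; rewrite /dsum_act /= !linearP.
Qed.
HB.instance Definition _ M N a := GRing.isSemilinear.Build K _ _ _
  (@dsum_act M N a) (GRing.semilinear_linear (@dsum_act_is_linear M N a)).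

Definition dsum M N : rmod A.
Proof.
refine (@RMod K A (M * N)%type (fun a => linfun (@dsum_act M N a)) _ _ _).
- move=> c a b; apply/lfunP => -[x y].
  rewrite add_lfunE scale_lfunE !lfunE /= /dsum_act /=.
  by rewrite !ract_linear !add_lfunE !scale_lfunE.
- by apply/lfunP => -[x y]; rewrite lfunE /= /dsum_act !ract1 !id_lfunE.
- move=> a b; apply/lfunP => -[x y].
  by rewrite comp_lfunE !lfunE /= /dsum_act !ractM !comp_lfunE.
Defined.

Definition dsums (s : seq (rmod A)) : rmod A := foldr dsum rmod0 s.

Section Kernel.
Variables (M N : rmod A) (f : rhom M N).

Fact rker_act_subproof a (x : subvs_of (lker f)) :
  ract M a (vsval x) \in lker f.
Proof.
by have := subvsP x; rewrite !memv_ker rhomA => /eqP ->; rewrite linear0.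
Qed.
Definition rker_act a (x : subvs_of (lker f)) : subvs_of (lker f) :=
  Subvs (rker_act_subproof a x).
Fact rker_act_is_linear a : linear (rker_act a).
Proof. by move=> c x y; apply: val_inj; rewrite /= !linearP. Qed.
HB.instance Definition _ a := GRing.isSemilinear.Build K _ _ _
  (rker_act a) (GRing.semilinear_linear (rker_act_is_linear a)).

Definition rker : rmod A.
Proof.
refine (@RMod K A (subvs_of (lker f)) (fun a => linfun (rker_act a)) _ _ _).
- move=> c a b; apply/lfunP => x; apply: val_inj.
  rewrite add_lfunE scale_lfunE !lfunE /=.
  by rewrite ract_linear add_lfunE scale_lfunE.
- by apply/lfunP => x; apply: val_inj; rewrite lfunE /= ract1 !id_lfunE.
- move=> a b; apply/lfunP => x; apply: val_inj.
  by rewrite comp_lfunE !lfunE /= ractM comp_lfunE.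
Defined.
End Kernel.

(* The Nakayama functor D Hom_A(-, A), where D = Hom_K(-, K): the left        *)
(* A-module structure (a h)(x) = a h(x) of Hom_A(M, A) induces the right      *)
(* A-module structure (phi a)(h) = phi(a h) of its dual.                      *)
Section Nakayama.
Variable M : rmod A.
Notation dualM := (rhom M rmod_regular).

Fact lscale_subproof (a : A) (h : dualM) :
  (amull a : 'End(rmod_regular)) \o h \in rhom_space M rmod_regular.
Proof.
apply/rhom_spaceP => b x; rewrite !comp_lfunE rhomA.
have mE c (y : A) : amull c y = c * y by rewrite lfunE.
have rE c (y : A) : amulr c y = y * c by rewrite lfunE.
by rewrite [RHS]rE !mE rE mulrA.
Qed.
Definition lscale (a : A) (h : dualM) : dualM := Subvs (lscale_subproof a h).
Lemma lscaleE a h x : lscale a h x = a * (h x : A).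
Proof. by rewrite /lscale /rhom_lfun comp_lfunE [LHS]lfunE. Qed.

Fact lscale_is_linear a : linear (lscale a).
Proof.
by move=> c f g; apply: rhomP => x; rewrite rhomDZE !lscaleE rhomDZE mulrDr -scalerAr.
Qed.
HB.instance Definition _ a := GRing.isSemilinear.Build K _ _ _
  (lscale a) (GRing.semilinear_linear (lscale_is_linear a)).

Definition nakayama_act (a : A) (phi : 'Hom(dualM, K^o)) : 'Hom(dualM, K^o) :=
  phi \o linfun (lscale a).
Lemma nakayama_actE a phi h : nakayama_act a phi h = phi (lscale a h).
Proof. by rewrite comp_lfunE lfunE. Qed.
Fact nakayama_act_is_linear a : linear (nakayama_act a).
Proof.
move=> c f g; apply/lfunP => h.
by rewrite !(nakayama_actE, add_lfunE, scale_lfunE).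
Qed.
HB.instance Definition _ a := GRing.isSemilinear.Build K _ _ _
  (nakayama_act a) (GRing.semilinear_linear (nakayama_act_is_linear a)).

Definition nakayama : rmod A.
Proof.
refine (@RMod K A 'Hom(dualM, K^o) (fun a => linfun (nakayama_act a)) _ _ _).
- move=> c a b; apply/lfunP => phi; apply/lfunP => h.
  rewrite add_lfunE scale_lfunE !(lfunE (nakayama_act _)) add_lfunE scale_lfunE.
  rewrite !nakayama_actE -linearP; congr (phi _); apply: rhomP => x.
  by rewrite rhomDZE !lscaleE mulrDl scalerAl.
- apply/lfunP => phi; apply/lfunP => h; rewrite lfunE nakayama_actE id_lfunE.
  by congr (phi _); apply: rhomP => x; rewrite lscaleE mul1r.
- move=> a b; apply/lfunP => phi; apply/lfunP => h.
  rewrite comp_lfunE !(lfunE (nakayama_act _)) !nakayama_actE.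
  by congr (phi _); apply: rhomP => x; rewrite !lscaleE mulrA.
Defined.
Lemma ract_nakayamaE a phi : ract nakayama a phi = nakayama_act a phi.
Proof. exact: (lfunE (nakayama_act a)). Qed.
End Nakayama.

Section NakayamaMap.
Variables (M N : rmod A) (f : rhom M N).

Definition rprecomp (h : rhom N rmod_regular) : rhom M rmod_regular :=
  rhom_comp h f.
Fact rprecomp_is_linear : linear rprecomp.
Proof.
move=> c g h; apply: rhomP => x.
by rewrite rhomDZE /rprecomp !rhom_compE rhomDZE.
Qed.
HB.instance Definition _ := GRing.isSemilinear.Build K _ _ _
  rprecomp (GRing.semilinear_linear rprecomp_is_linear).

Definition nakayama_fun (phi : nakayama M) : nakayama N :=
  (phi : 'Hom(rhom M rmod_regular, K^o)) \o linfun rprecomp.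
Lemma nakayama_funE phi h :
  (nakayama_fun phi : 'Hom(rhom N rmod_regular, K^o)) h
  = (phi : 'Hom(rhom M rmod_regular, K^o)) (rhom_comp h f).
Proof. by rewrite comp_lfunE lfunE. Qed.
Fact nakayama_fun_is_linear : linear nakayama_fun.
Proof.
move=> c phi psi; apply/lfunP => h.
by rewrite add_lfunE scale_lfunE !nakayama_funE add_lfunE scale_lfunE.
Qed.
HB.instance Definition _ := GRing.isSemilinear.Build K _ _ _
  nakayama_fun (GRing.semilinear_linear nakayama_fun_is_linear).

Fact nakayama_map_subproof :
  linfun nakayama_fun \in rhom_space (nakayama M) (nakayama N).
Proof.
apply/rhom_spaceP => a phi; rewrite !(lfunE nakayama_fun).
apply/lfunP => h; rewrite nakayama_funE.
rewrite !ract_nakayamaE !nakayama_actE nakayama_funE.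
congr ((phi : 'Hom(_, _)) _).
by apply: rhomP => x; rewrite lscaleE !rhom_compE lscaleE.
Qed.
Definition nakayama_map : rhom (nakayama M) (nakayama N) :=
  Subvs nakayama_map_subproof.
End NakayamaMap.

End Constructions.

(* Full subcategories of mod A, as predicates on objects.                     *)
Definition subcat (K : fieldType) (A : falgType K) : Type := rmod A -> Prop.

Definition subcatI (K : fieldType) (A : falgType K) (S T : subcat A) : subcat A :=
  fun X => S X /\ T X.
Definition sub_subcat (K : fieldType) (A : falgType K) (S T : subcat A) : Prop :=
  forall X, S X -> T X.
Definition eq_subcat (K : fieldType) (A : falgType K) (S T : subcat A) : Prop :=
  forall X, S X <-> T X.

Declare Scope subcat_scope.
Delimit Scope subcat_scope with subcat.
Bind Scope subcat_scope with subcat.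
Notation "S `&` T" := (subcatI S T) (at level 48, left associativity)
  : subcat_scope.
Notation "S `<=` T" := (sub_subcat S T) (at level 70, no associativity)
  : subcat_scope.
Notation "S `=` T" := (eq_subcat S T) (at level 70, no associativity)
  : subcat_scope.
Local Open Scope subcat_scope.

Section ModuleTheory.
Variables (K : fieldType) (A : falgType K).
Implicit Types (M N P Q U X Y : rmod A) (C S T F : subcat A).

Definition hom0 X Y := forall f : rhom X Y, f = 0.
Definition rzero M := forall x : M, x = 0.

Definition rprojective P := forall X Y (e : rhom X Y) (g : rhom P Y),
  repi e -> exists h : rhom P X, rhom_comp e h = g.

Definition superfluous M (U : {vspace M}) :=
  forall L : {vspace M}, submodule L -> (L + U)%VS = fullv -> L = fullv.

(* P1 -> P0 -> M -> 0 exact, with P0 -> M and P1 -> im p1 projective covers.  *)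
Definition minimal_projective_presentation M P1 P0
    (p1 : rhom P1 P0) (p0 : rhom P0 M) :=
  [/\ rprojective P1, rprojective P0, repi p0, limg p1 = lker p0 &
      superfluous (lker p0) /\ superfluous (lker p1)].

(* tau M = D Tr M: as Tr M is the cokernel of Hom_A(p1, A), its dual is the   *)
(* kernel of D Hom_A(p1, A) : nakayama P1 -> nakayama P0.                     *)
Definition is_tau M N := exists P1 P0 (p1 : rhom P1 P0) (p0 : rhom P0 M),
  minimal_projective_presentation p1 p0 /\ N = rker (nakayama_map p1).

(* tau M is only defined up to isomorphism, so some choice is made.  Minimal  *)
(* projective presentations always exist; the second branch is never taken.   *)
Definition tau M : rmod A :=
  if pselect (exists N, is_tau M N) is left h then sval (cid h) else rmod0 A.

Definition rperp X : subcat A := fun Y => hom0 X Y.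
Definition lperp X : subcat A := fun Y => hom0 Y X.

Definition dsummand X M := exists Y, riso M (dsum X Y).
Definition radd M : subcat A :=
  fun X => exists n, dsummand X (dsums (nseq n M)).
Definition Fac M : subcat A :=
  fun N => exists X, radd M X /\ exists f : rhom X N, repi f.

Definition indecomposable M :=
  ~ rzero M /\ forall X Y, riso M (dsum X Y) -> rzero X \/ rzero Y.

Definition basic M := exists n (X : 'I_n -> rmod A),
  [/\ forall i, indecomposable (X i),
      forall i j, riso (X i) (X j) -> i = j &
      riso M (dsums [seq X i | i <- enum 'I_n])].

(* |M| = n *)
Definition num_summands M (n : nat) := exists X : 'I_n -> rmod A,
  [/\ forall i, indecomposable (X i) /\ dsummand (X i) M,
      forall i j, riso (X i) (X j) -> i = j &
      forall Y, indecomposable Y -> dsummand Y M -> exists i, riso Y (X i)].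

Definition tau_rigid_pair M P :=
  [/\ rprojective P, hom0 M (tau M) & hom0 P M].

Definition tau_tilting_pair M P :=
  tau_rigid_pair M P /\
  exists m p, [/\ num_summands M m, num_summands P p &
                  num_summands (rmod_regular A) (m + p)].

Definition basic_pair M P := basic M /\ basic P.

Definition iso_closed T := forall X Y, riso X Y -> T X -> T Y.
Definition subcategory C T := iso_closed T /\ T `<=` C.

Definition torsion_pair C T F :=
  [/\ subcategory C T, subcategory C F,
      forall X Y, T X -> F Y -> hom0 X Y &
      forall X, C X -> exists Xt Xf (i : rhom Xt X) (p : rhom X Xf),
        [/\ T Xt, F Xf & short_exact i p]].

Definition torsion_class C T := exists F, torsion_pair C T F.

Definition has_left_approx S M := exists N (f : rhom M N),
  S N /\ forall N' (g : rhom M N'), S N' ->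
    exists h : rhom N N', rhom_comp h f = g.

Definition has_right_approx S M := exists N (f : rhom N M),
  S N /\ forall N' (g : rhom N' M), S N' ->
    exists h : rhom N' N, rhom_comp f h = g.

Definition functorially_finite C S :=
  forall M, C M -> has_left_approx S M /\ has_right_approx S M.

Definition rmodT : subcat A := fun _ => True.

Definition tors U Q T :=
  [/\ torsion_class rmodT T, Fac U `<=` T &
      T `<=` lperp (tau U) `&` rperp Q].

Definition ftors U Q T := tors U Q T /\ functorially_finite rmodT T.

Definition star S T : subcat A :=
  fun N => exists X Y (f : rhom X N) (g : rhom N Y),
    [/\ S X, T Y & short_exact f g].

Definition wide_of U Q : subcat A :=
  rperp U `&` lperp (tau U) `&` rperp Q.

(* (N, R) is B^-_{(U, Q)}(M, P). *)
Definition left_Bongartz_completion U Q M P N R :=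
  let T := star (Fac U) (wide_of U Q `&` Fac M) in
  [/\ ftors U Q T, basic_pair N R, tau_tilting_pair N R & Fac N `=` T].

Definition left_Bongartz_completion_exists U Q M P :=
  exists N R, left_Bongartz_completion U Q M P N R.

End ModuleTheory.

(* Main.v *)
From HB Require Import structures.
Require Import Defs.
From mathcomp Require Import all_boot all_algebra falgebra.
From mathcomp Require Import boolp.

(* For a minimal projective presentation [P1 -> P0 -> V -> 0], the identity
   [Hom(X, nu P) = D Hom(P, X)] shows that [Hom(X, tau V) = 0] iff every map
   [P1 -> X] factors through [P0]; this gives the vanishing of [Ext^1(V, X)].  A module
   lies in [Fac U * (W /\ Fac M)] iff it lies in the torsion class
   [^bot(tau U) /\ Q^bot] and its [U]-torsion-free quotient lies in [Fac M], and
   this description is stable under quotients and extensions.  Left approximations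
   into [Fac U * Fac M] are pushouts of left approximations into the two factors.

   For the completion, a functorially finite torsion class [T] is [Fac N], where
   [N] collects the Ext-projective terms of the minimal left [T]-approximation
   sequences [P_k -> T0 -> T1 -> 0] of the indecomposable projectives.  On [T] the
   functions [hom(N_i, -)] and [hom(P_k, -)], for [P_k] in the support of [T], are
   integral combinations of each other, and each family has a dual basis of
   differences of modules in [T]; so both have the same number of members. *)

Set Implicit Arguments.
Unset Strict Implicit.
Unset Printing Implicit Defensive.

Import GRing.Theory.
Local Open Scope ring_scope.
Local Open Scope subcat_scope.

(** * Kernels, quotients and direct sums *)

(** The vanishing of [Ext^1(V, X)] is phrased as the lifting of maps from [V] along short exact
    sequences that start at [X]. It follows from [Hom(X, tau V) = 0], but for a single [X] the
    converse fails. In the reduction, the obstacle is that a quotient of a [U]-torsion-free module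
    may receive maps from [U]. What controls this is [Ext^1(U, L) = 0] for [L] in [^bot(tau U)]. In
    the completion, the obstacle is the number of summands. Integral coefficients multiplied by Hom
    dimensions at the test modules give a diagonal matrix. Over an arbitrary field the endomorphism
    ring of an indecomposable is local, but its residue ring may be larger than [K]. The diagonal
    entries are therefore only positive integers, and the ranks are compared over the rationals. *)

Lemma ex_maxdim T (P : T -> Prop) (d : T -> nat) b :
    (exists t, P t) -> (forall t, P t -> (d t <= b)%N) ->
  exists2 t, P t & forall t', P t' -> (d t' <= d t)%N.
Proof.
elim: b => [|b IHb] [t Pt] Pb.
  by exists t => // t' /Pb; rewrite leqn0 => /eqP->.
have [[u [Pu du]]|noU] := pselect (exists u, P u /\ d u = b.+1).
  by exists u => // t' /Pb; rewrite du.
apply: IHb; first by exists t.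
move=> u Pu; rewrite -ltnS ltn_neqAle Pb // andbT.
by apply/eqP => du; apply: noU; exists u.
Qed.

Lemma ex_mindim T (P : T -> Prop) (d : T -> nat) :
    (exists t, P t) ->
  exists2 t, P t & forall t', P t' -> (d t <= d t')%N.
Proof.
move=> [t Pt].
(* Minimising [d] is maximising [d t - d u] among the [u] with [d u <= d t], where truncated
   subtraction does no harm. *)
have [u [Pu du] uM] := @ex_maxdim _ (fun u => P u /\ (d u <= d t)%N)
  (fun u => d t - d u)%N (d t) (ex_intro _ t (conj Pt (leqnn _)))
  (fun u _ => leq_subr _ _).
exists u => // t' Pt'; rewrite leqNgt; apply/negP => lt.
have := uM t' (conj Pt' (leq_trans (ltnW lt) du)).
by rewrite leqNgt ltn_sub2l // (leq_trans lt).
Qed.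

Section Homs.
Variables (K : fieldType) (A : falgType K).
Implicit Types M N L X Y Z E C : rmod A.

Notation mdim M := (\dim {: rmod_car M}).

Lemma rhomD0 M N x : rhom_lfun (0 : rhom M N) x = 0.
Proof. by rewrite /rhom_lfun linear0 zero_lfunE. Qed.
Lemma rhomDE M N (f g : rhom M N) x : rhom_lfun (f + g) x = f x + g x.
Proof. by rewrite /rhom_lfun linearD add_lfunE. Qed.
Lemma rhomNE M N (f : rhom M N) x : rhom_lfun (- f) x = - f x.
Proof. by rewrite /rhom_lfun linearN opp_lfunE. Qed.
Lemma rhomBE M N (f g : rhom M N) x : rhom_lfun (f - g) x = f x - g x.
Proof. by rewrite rhomDE rhomNE. Qed.
Lemma rhom_ex M N (f : M -> N) : linear f ->
    (forall a x, f (ract M a x) = ract N a (f x)) ->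
  exists g : rhom M N, forall x, g x = f x.
Proof.
move=> fl fA.
pose m := GRing.isSemilinear.Build K _ _ _ f (GRing.semilinear_linear fl).
pose F : {linear M -> N} := HB.pack f m.
have Fin : linfun F \in rhom_space M N.
  by apply/rhom_spaceP => a x; rewrite !(lfunE F) /= fA.
by exists (Subvs Fin) => x; rewrite /rhom_lfun /= (lfunE F).
Qed.

Lemma ractD M a b x : ract M (a + b) x = ract M a x + ract M b x.
Proof. by rewrite -[a]scale1r ract_linear !scale1r add_lfunE. Qed.
Lemma ractZ M c a x : ract M (c *: a) x = c *: ract M a x.
Proof.
have r0 : ract M 0 = 0.
  have := ract_linear M 1 0 0; rewrite !scale1r addr0 => /(congr1 (fun f => f - ract M 0)).
  by rewrite addrK subrr => /esym.
by have := ract_linear M c a 0; rewrite r0 !addr0 => ->; rewrite scale_lfunE.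
Qed.
Lemma ractMx M a b x : ract M (a * b) x = ract M b (ract M a x).
Proof. by rewrite ractM comp_lfunE. Qed.
Lemma ract1x M x : ract M 1 x = x.
Proof. by rewrite ract1 id_lfunE. Qed.

Lemma rmonoP M N (f : rhom M N) : rmono f <-> forall x, f x = 0 -> x = 0.
Proof.
split=> [f0 x fx|f0]; first by apply/eqP; rewrite -memv0 -f0 memv_ker fx.
by apply/vspaceP => x; rewrite memv_ker memv0; apply/eqP/eqP => [/f0|->] //; rewrite linear0.
Qed.

Lemma rmono_inj M N (f : rhom M N) : rmono f -> injective f.
Proof. by move/eqP/lker0P. Qed.

Lemma rimP M N (f : rhom M N) y : y \in limg f <-> exists x, f x = y.
Proof.
split=> [/memv_imgP[x _ ->]|[x <-]]; first by exists x.
by rewrite memv_img ?memvf.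
Qed.

Lemma repiP M N (f : rhom M N) : repi f <-> forall y, exists x, f x = y.
Proof.
split=> [f1 y|f1]; first by apply/rimP; rewrite f1 memvf.
by apply/vspaceP => y; rewrite memvf; apply/rimP.
Qed.

Lemma exactP L M N (f : rhom L M) (g : rhom M N) :
  limg f = lker g <-> forall y, g y = 0 <-> exists x, f x = y.
Proof.
split=> [fg y|fg]; first by rewrite -rimP fg memv_ker; split=> /eqP.
apply/vspaceP => y; rewrite memv_ker; apply/idP/eqP.
  by move/rimP/fg.
by move/fg/rimP.
Qed.

Lemma submoduleP M (V : {vspace M}) :
  submodule V <-> forall a x, x \in V -> ract M a x \in V.
Proof.
split=> [sV a x xV|sV a]; first by apply: (subvP (sV a)); apply: memv_img.
by apply/subvP => _ /memv_imgP[x xV ->]; apply: sV.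
Qed.

Lemma submodule_ker M N (f : rhom M N) : submodule (lker f).
Proof.
by apply/submoduleP => a x; rewrite !memv_ker rhomA => /eqP->; rewrite linear0.
Qed.

Lemma submodule_im M N (f : rhom M N) : submodule (limg f).
Proof.
by apply/submoduleP => a _ /rimP[x <-]; rewrite -rhomA; apply/rimP; exists (ract M a x).
Qed.

Definition rid M : rhom M M := Subvs (introT (rhom_spaceP \1%VF)
  (fun a x => etrans (id_lfunE _) (congr1 (ract M a) (esym (id_lfunE x))))).
Lemma ridE M x : rid M x = x.
Proof. exact: id_lfunE. Qed.

Lemma epi_factor M C N (e : rhom M C) (f : rhom M N) : repi e ->
  (forall x, e x = 0 -> f x = 0) -> exists g : rhom C N, forall x, g (e x) = f x.
Proof.
move=> /repiP eP ef.
(* [s] is only a [K]-linear section of [e]. As [f] vanishes on the kernel of [e], the composite with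
   [f] does not depend on it and is [A]-linear. *)
pose s := (rhom_lfun e)^-1%VF.
have es y : e (s y) = y.
  by rewrite limg_lfunVK //; apply/rimP; apply: eP.
have fs x : f (s (e x)) = f x.
  apply/eqP; rewrite -subr_eq0 -linearB; apply/eqP/ef.
  by rewrite linearB /= es subrr.
have [|a y|g gE] := @rhom_ex C N (fun y => f (s y)).
- by move=> c x y; rewrite !linearP.
- by have [x <-] := eP y; rewrite -rhomA !fs rhomA.
by exists g => x; rewrite gE fs.
Qed.

Lemma mono_factor X M N (i : rhom X M) (f : rhom N M) : rmono i ->
  (forall x, exists y, i y = f x) -> exists g : rhom N X, forall x, i (g x) = f x.
Proof.
move=> im fi.
pose s := (rhom_lfun i)^-1%VF.
have is' x : i (s (f x)) = f x.
  by rewrite limg_lfunVK //; apply/rimP; apply: fi.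
have [|a y|g gE] := @rhom_ex N X (fun y => s (f y)).
- by move=> c x y; rewrite !linearP.
- by apply: (rmono_inj im); rewrite is' [RHS]rhomA is' rhomA.
by exists g => x; rewrite gE is'.
Qed.

Lemma sub_ex M (V : {vspace M}) : submodule V ->
  exists X (i : rhom X M), rmono i /\ limg i = V.
Proof.
move=> /submoduleP sV.
have Hsub a (x : subvs_of V) : ract M a (vsval x) \in V by apply/sV/subvsP.
pose act a (x : subvs_of V) : subvs_of V := Subvs (Hsub a x).
have al a : linear (act a) by move=> c x y; apply: val_inj; rewrite /= !linearP.
pose m a := GRing.isSemilinear.Build K _ _ _ (act a) (GRing.semilinear_linear (al a)).
pose F a : {linear subvs_of V -> subvs_of V} := HB.pack (act a) (m a).
have H1 : linear (fun a => linfun (F a)).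
  move=> c a b; apply/lfunP => x; apply: val_inj.
  by rewrite add_lfunE scale_lfunE !lfunE /= ract_linear add_lfunE scale_lfunE.
have H2 : linfun (F 1) = \1%VF.
  by apply/lfunP => x; apply: val_inj; rewrite lfunE /= ract1 !id_lfunE.
have H3 a b : linfun (F (a * b)) = (linfun (F b) \o linfun (F a))%VF.
  by apply/lfunP => x; apply: val_inj; rewrite comp_lfunE !lfunE /= ractM comp_lfunE.
pose X := @RMod K A (subvs_of V) (fun a => linfun (F a)) H1 H2 H3.
have [c x y|a x|i iE] := @rhom_ex X M (fun x => vsval (x : subvs_of V)).
- by rewrite linearP.
- by rewrite lfunE.
exists X, i; split.
  by apply/rmonoP => x; rewrite iE => x0; apply: val_inj.
apply/vspaceP => y; apply/idP/idP => [/rimP[x <-]|yV]; first by rewrite iE subvsP.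
by apply/rimP; exists (Subvs yV); rewrite iE.
Qed.

Lemma quo_ex M (V : {vspace M}) : submodule V ->
  exists Y (p : rhom M Y), repi p /\ lker p = V.
Proof.
move=> /submoduleP sV.
(* The quotient is carried by the image of [f], a vector space complement of [V]. The action is that
   of [M] followed by [f]. *)
pose f : 'End(M) := (\1 - projv V)%VF.
have fE x : f x = x - projv V x by rewrite add_lfunE opp_lfunE id_lfunE.
have fV x : (f x == 0) = (x \in V).
  rewrite fE subr_eq0; apply/eqP/idP => [->|/projv_id->//]; exact: memv_proj.
have fx x : x - f x \in V by rewrite fE opprB addrC subrK memv_proj.
clearbody f.
pose act a (x : subvs_of (limg f)) : subvs_of (limg f) := vsproj (limg f) (f (ract M a (vsval x))).
have vact a x : vsval (act a x) = f (ract M a (vsval x)).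
  by rewrite vsprojK // memv_img ?memvf.
have al a : linear (act a).
  move=> c x y; apply: val_inj; rewrite [LHS]vact linearP /= !vact.
  by rewrite !linearP.
pose m a := GRing.isSemilinear.Build K _ _ _ (act a) (GRing.semilinear_linear (al a)).
pose F a : {linear subvs_of (limg f) -> subvs_of (limg f)} := HB.pack (act a) (m a).
have ff x : f (f x) = f x.
  by apply/eqP; rewrite -subr_eq0 -linearB fV -memvN opprB fx.
have fid (x : subvs_of (limg f)) : f (vsval x) = vsval x.
  by case/memv_imgP: (subvsP x) => y _ ->.
have fact a x : f (ract M a (f x)) = f (ract M a x).
  by apply/eqP; rewrite -subr_eq0 -!linearB fV sV // -memvN opprB fx.
have H1 : linear (fun a => linfun (F a)).
  move=> c a b; apply/lfunP => x; apply: val_inj.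
  rewrite add_lfunE scale_lfunE !lfunE /= !vact ract_linear.
  by rewrite add_lfunE scale_lfunE linearP.
have H2 : linfun (F 1) = \1%VF.
  by apply/lfunP => x; apply: val_inj; rewrite lfunE /= vact ract1 !id_lfunE fid.
have H3 a b : linfun (F (a * b)) = (linfun (F b) \o linfun (F a))%VF.
  by apply/lfunP => x; apply: val_inj; rewrite comp_lfunE !lfunE /= !vact fact ractM comp_lfunE.
pose X := @RMod K A (subvs_of (limg f)) (fun a => linfun (F a)) H1 H2 H3.
have [c x y|a x|p pE] := @rhom_ex M X (fun x => vsproj (limg f) (f x)).
- by rewrite !linearP.
- by apply: val_inj; rewrite lfunE /= vact !vsprojK ?memv_img ?memvf.
exists X, p; split.
  apply/repiP => y; exists (vsval (y : subvs_of (limg f))).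
  by rewrite pE fid vsvalK.
apply/vspaceP => y; rewrite memv_ker -fV pE; apply/eqP/eqP => [/(congr1 vsval)|->].
  by rewrite vsprojK ?memv_img ?memvf // linear0.
by rewrite linear0.
Qed.

Lemma coker_ex L M (f : rhom L M) :
  exists Y (p : rhom M Y), repi p /\ limg f = lker p.
Proof.
have [Y [p [p1 p2]]] := quo_ex (submodule_im f).
by exists Y, p.
Qed.

Lemma ker_ex M N (f : rhom M N) :
  exists X (i : rhom X M), rmono i /\ limg i = lker f.
Proof. exact: sub_ex (@submodule_ker _ _ f). Qed.

Lemma im_ex M N (f : rhom M N) :
  exists I (q : rhom M I) (j : rhom I N), [/\ repi q, rmono j & forall x, j (q x) = f x].
Proof.
have [I [j [jm jE]]] := sub_ex (submodule_im f).
have [|q qE] := @mono_factor I N M j f jm.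
  by move=> x; apply/rimP; rewrite jE; apply/rimP; exists x.
exists I, q, j; split => //.
apply/repiP => y; have: j y \in limg j by apply/rimP; exists y.
by rewrite jE => /rimP[x jx]; exists x; apply: (rmono_inj jm); rewrite qE.
Qed.

Lemma short_exactP L M N (f : rhom L M) (g : rhom M N) :
  short_exact f g <-> [/\ rmono f, repi g & forall y, g y = 0 <-> exists x, f x = y].
Proof. by split=> -[? ? ?]; split => //; apply/exactP. Qed.

Lemma rmono_comp L M N (g : rhom M N) (f : rhom L M) :
  rmono g -> rmono f -> rmono (rhom_comp g f).
Proof.
by move=> /rmonoP g0 /rmonoP f0; apply/rmonoP => x; rewrite rhom_compE => /g0/f0.
Qed.

Lemma repi_comp L M N (g : rhom M N) (f : rhom L M) :
  repi g -> repi f -> repi (rhom_comp g f).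
Proof.
move=> /repiP g0 /repiP f0; apply/repiP => z; have [y <-] := g0 z; have [x <-] := f0 y.
by exists x; rewrite rhom_compE.
Qed.

Lemma rmono_dim M N (f : rhom M N) : rmono f -> (mdim M <= mdim N)%N.
Proof.
move=> f0; have <- : \dim (limg f) = mdim M by apply: limg_dim_eq; rewrite f0 capv0.
by rewrite dimvS ?subvf.
Qed.

Lemma repi_dim M N (f : rhom M N) : repi f -> (mdim N <= mdim M)%N.
Proof.
move=> f1; have := limg_ker_dim f fullv; rewrite (f1 : limg f = _) => <-.
by rewrite leq_addl.
Qed.

Lemma short_exact_dim L M N (f : rhom L M) (g : rhom M N) :
  short_exact f g -> mdim M = (mdim L + mdim N)%N.
Proof.
move=> [f0 fg g1]; have := limg_ker_dim g fullv.
by rewrite capfv -fg g1 (limg_dim_eq (f := f)) ?f0 ?capv0 // => <-.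
Qed.

Lemma rmono_epi_dim M N (f : rhom M N) : rmono f -> (mdim N <= mdim M)%N -> repi f.
Proof.
move=> f0 le; apply/eqP; rewrite eqEdim subvf /=.
by rewrite (limg_dim_eq (f := f)) // f0 capv0.
Qed.

Lemma repi_mono_dim M N (f : rhom M N) : repi f -> (mdim M <= mdim N)%N -> rmono f.
Proof.
move=> f0 le; apply/eqP; rewrite -dimv_eq0 -leqn0.
have := limg_ker_dim f fullv; rewrite capfv f0 => d.
by rewrite -(leq_add2r (mdim N)) add0n d.
Qed.

Lemma rzeroP M : rzero M <-> mdim M = 0%N.
Proof.
split=> [M0|/eqP]; last first.
  by rewrite dimv_eq0 => /eqP M0 x; apply/eqP; rewrite -memv0 -M0 memvf.
by apply/eqP; rewrite dimv_eq0; apply/eqP/vspaceP => x; rewrite memvf memv0 (M0 x) eqxx.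
Qed.

Lemma rhom_inv M N (f : rhom M N) : rmono f -> repi f ->
  exists g : rhom N M, (forall x, g (f x) = x) /\ (forall y, f (g y) = y).
Proof.
move=> fm fe; have [|g gE] := mono_factor (f := rid N) fm.
  by move=> y; rewrite ridE; exact: (repiP f).1.
have gE' y : f (g y) = y by rewrite gE ridE.
by exists g; split => // x; apply: (rmono_inj fm); rewrite gE'.
Qed.

Lemma riso_refl M : riso M M.
Proof.
exists (rid M); split; first by apply/rmonoP => x; rewrite ridE.
by apply/repiP => x; exists x; rewrite ridE.
Qed.

Lemma risoP M N : riso M N <-> exists (f : rhom M N) (g : rhom N M),
  (forall x, g (f x) = x) /\ (forall y, f (g y) = y).
Proof.
split=> [[f [f0 f1]]|[f [g [gf fg]]]].
  by have [g ?] := rhom_inv f0 f1; exists f, g.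
exists f; split; first by apply/rmonoP => x fx; rewrite -(gf x) fx linear0.
by apply/repiP => y; exists (g y).
Qed.

Lemma riso_sym M N : riso M N -> riso N M.
Proof. by move=> /risoP[f [g [gf fg]]]; apply/risoP; exists g, f. Qed.

Lemma riso_trans N M L : riso M N -> riso N L -> riso M L.
Proof.
move=> [f [f0 f1]] [g [g0 g1]]; exists (rhom_comp g f).
by split; [apply: rmono_comp | apply: repi_comp].
Qed.

Lemma riso_dim M N : riso M N -> mdim M = mdim N.
Proof.
move=> [f [f0 f1]]; apply/eqP; rewrite eqn_leq.
by rewrite (rmono_dim f0) (repi_dim f1).
Qed.

Lemma rzero_riso M : rzero M -> riso M (rmod0 A).
Proof.
move=> M0; exists 0; split; first by apply/rmonoP => x _; apply: M0.
by apply/repiP => -y; exists 0; rewrite linear0; apply/rowP => -[].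
Qed.

Lemma rmod0_zero : rzero (rmod0 A).
Proof. by move=> x; apply/rowP => -[]. Qed.

Lemma hom0P M N : hom0 M N <-> forall (f : rhom M N) x, f x = 0.
Proof.
split=> [h f x|h f]; first by rewrite (h f) rhomD0.
by apply: rhomP => x; rewrite h rhomD0.
Qed.

(** * Direct sums and direct summands *)

Section Sums.
Variables M N : rmod A.

Lemma dsum_actE a (x : M) (y : N) : ract (dsum M N) a (x, y) = (ract M a x, ract N a y).
Proof. by rewrite /= lfunE. Qed.

Lemma inl_ex : exists i : rhom M (dsum M N), forall x, i x = (x, 0).
Proof.
apply: rhom_ex => [c x y|a x]; last by rewrite dsum_actE linear0.
by congr pair; rewrite /= scaler0 addr0.
Qed.
Lemma inr_ex : exists i : rhom N (dsum M N), forall x, i x = (0, x).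
Proof.
apply: rhom_ex => [c x y|a x]; last by rewrite dsum_actE linear0.
by congr pair; rewrite /= scaler0 addr0.
Qed.
Lemma fst_ex : exists i : rhom (dsum M N) M, forall x, i x = x.1.
Proof. by apply: rhom_ex => [c x y|a [x y]]; last rewrite dsum_actE. Qed.
Lemma snd_ex : exists i : rhom (dsum M N) N, forall x, i x = x.2.
Proof. by apply: rhom_ex => [c x y|a [x y]]; last rewrite dsum_actE. Qed.

Lemma copair_ex L (f : rhom M L) (g : rhom N L) :
  exists h : rhom (dsum M N) L, forall x, h x = f x.1 + g x.2.
Proof.
apply: rhom_ex => [c x y|a [x y]]; last by rewrite dsum_actE /= !rhomA linearD.
by rewrite !linearP scalerDr addrACA.
Qed.

Lemma pair_ex L (f : rhom L M) (g : rhom L N) :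
  exists h : rhom L (dsum M N), forall x, h x = (f x, g x).
Proof.
by apply: rhom_ex => [c x y|a x]; rewrite ?dsum_actE ?rhomA // !linearP.
Qed.
End Sums.

Lemma dsum_riso M M' N N' : riso M M' -> riso N N' -> riso (dsum M N) (dsum M' N').
Proof.
move=> /risoP[f [f' [ff' f'f]]] /risoP[g [g' [gg' g'g]]].
have [p1 p1E] := fst_ex M N; have [p2 p2E] := snd_ex M N.
have [q1 q1E] := fst_ex M' N'; have [q2 q2E] := snd_ex M' N'.
have [h hE] := pair_ex (rhom_comp f p1) (rhom_comp g p2).
have [k kE] := pair_ex (rhom_comp f' q1) (rhom_comp g' q2).
apply/risoP; exists h, k; split=> -[x y].
  by rewrite kE !rhom_compE q1E q2E hE !rhom_compE p1E p2E /= ff' gg'.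
by rewrite hE !rhom_compE p1E p2E kE !rhom_compE q1E q2E /= f'f g'g.
Qed.

Lemma dsum_assoc L M N : riso (dsum (dsum L M) N) (dsum L (dsum M N)).
Proof.
have [//|a [[x y] z]|f fE] := @rhom_ex (dsum (dsum L M) N) (dsum L (dsum M N))
  (fun x => (x.1.1, (x.1.2, x.2))).
  by rewrite !dsum_actE.
have [//|a [x [y z]]|g gE] := @rhom_ex (dsum L (dsum M N)) (dsum (dsum L M) N)
  (fun x => ((x.1, x.2.1), x.2.2)).
  by rewrite !dsum_actE.
apply/risoP; exists f, g; split.
  by move=> [[x y] z]; rewrite gE fE.
by move=> [x [y z]]; rewrite fE gE.
Qed.

Lemma dsum_comm M N : riso (dsum M N) (dsum N M).
Proof.
have sw X Y : exists f : rhom (dsum X Y) (dsum Y X), forall x, f x = (x.2, x.1).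
  by apply: rhom_ex => [//|a [x y]]; rewrite !dsum_actE.
have [f fE] := sw M N; have [g gE] := sw N M.
by apply/risoP; exists f, g; split => -[x y]; rewrite ?fE gE ?fE.
Qed.

Lemma dsum0r M N : rzero N -> riso M (dsum M N).
Proof.
move=> N0; have [i iE] := inl_ex M N; exists i; split.
  by apply/rmonoP => x; rewrite iE => -[].
by apply/repiP => -[x y]; exists x; rewrite iE (N0 y).
Qed.

Lemma dsums_cat (s t : seq (rmod A)) : riso (dsums (s ++ t)) (dsum (dsums s) (dsums t)).
Proof.
elim: s => [|X s IHs] /=.
  exact: riso_trans (dsum0r _ rmod0_zero) (dsum_comm _ _).
apply: riso_trans (riso_sym (dsum_assoc _ _ _)).
exact: dsum_riso (riso_refl _) IHs.
Qed.

Lemma dsum_short_exact M N : exists (i : rhom M (dsum M N)) (p : rhom (dsum M N) N),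
  short_exact i p.
Proof.
have [i iE] := inl_ex M N; have [p pE] := snd_ex M N; exists i, p.
apply/short_exactP; split.
- by apply/rmonoP => x; rewrite iE => -[].
- by apply/repiP => y; exists (0, y); rewrite pE.
move=> [x y]; rewrite pE /=; split=> [->|[z]]; first by exists x; rewrite iE.
by rewrite iE => -[].
Qed.

Lemma dsum_dim M N : mdim (dsum M N) = (mdim M + mdim N)%N.
Proof. by have [i [p ip]] := dsum_short_exact M N; apply: short_exact_dim ip. Qed.

(** By dimension an injective endomorphism of [X] is invertible, so the kernel of [r] is a
    complement of the image of [s]. This is the form in which Fitting's lemma and local endomorphism
    rings deliver summands. *)
Lemma retract_dsummand X M (s : rhom X M) (r : rhom M X) :
  rmono (rhom_comp r s) -> dsummand X M.
Proof.
move=> rs0; have rs1 := rmono_epi_dim rs0 (leqnn _).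
have [t [tL tR]] := rhom_inv rs0 rs1.
have [Y [i [i0 iE]]] := ker_ex r; exists Y; apply: riso_sym.
have [f fE] := copair_ex s i; exists f.
have /exactP irE := iE.
split.
  apply/rmonoP => -[x y]; rewrite fE /= => f0.
  have x0 : x = 0.
    rewrite -(tL x) rhom_compE.
    have -> : r (s x) = r (s x + i y).
      by rewrite linearD /= (irE (i y)).2 ?addr0 //; exists y.
    by rewrite f0 !linear0.
  by move: f0; rewrite x0 linear0 add0r => /((rmonoP i).1 i0) ->.
apply/repiP => m; pose x := t (r m).
have : r (m - s x) = 0.
  by rewrite linearB /= -(rhom_compE r s) tR subrr.
move=> /irE[y iy]; exists (x, y); rewrite fE /= iy addrC subrK //.
Qed.

Lemma dsummandP X M : dsummand X M <->
  exists (s : rhom X M) (r : rhom M X), forall x, r (s x) = x.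
Proof.
split=> [[Y /risoP[f [g [gf fg]]]]|[s [r rs]]].
  have [i iE] := inl_ex X Y; have [p pE] := fst_ex X Y.
  exists (rhom_comp g i), (rhom_comp p f) => x.
  by rewrite !rhom_compE fg iE pE.
by apply: (@retract_dsummand X M s r); apply/rmonoP => x; rewrite rhom_compE rs.
Qed.

Lemma dsummand_trans Y X Z : dsummand X Y -> dsummand Y Z -> dsummand X Z.
Proof.
move=> /dsummandP[s [r rs]] /dsummandP[s' [r' rs']]; apply/dsummandP.
by exists (rhom_comp s' s), (rhom_comp r r') => x; rewrite !rhom_compE rs' rs.
Qed.

Lemma riso_dsummand X Y : riso X Y -> dsummand X Y.
Proof. by move=> /risoP[f [g [gf fg]]]; apply/dsummandP; exists f, g. Qed.

Lemma dsummand_dsuml X Y : dsummand X (dsum X Y).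
Proof. by exists Y; apply: riso_refl. Qed.
Lemma dsummand_dsumr X Y : dsummand Y (dsum X Y).
Proof. by exists X; apply: dsum_comm. Qed.

End Homs.

#[local] Arguments rhom_lfun : simpl never.
#[local] Arguments rhom_comp : simpl never.
#[local] Arguments rmod_car : simpl never.

(** * Projective presentations and the translate *)

Section Projectives.
Variables (K : fieldType) (A : falgType K).
Implicit Types M N L X Y Z E C P : rmod A.

Notation mdim M := (\dim {: rmod_car M}).
Notation reg := (rmod_regular A).

Lemma lfun_ex (V W : vectType K) (f : V -> W) : linear f ->
  exists F : 'Hom(V, W), forall x, F x = f x.
Proof.
move=> fl.
pose m := GRing.isSemilinear.Build K _ _ _ f (GRing.semilinear_linear fl).
pose F : {linear V -> W} := HB.pack f m.
by exists (linfun F) => x; rewrite (lfunE F).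
Qed.

Lemma functional_ex (V : vectType K) (W : {vspace V}) v : v \notin W ->
  exists xi : 'Hom(V, K^o), xi v != 0 /\ forall w, w \in W -> xi w = 0.
Proof.
move=> vW; pose f : 'End(V) := (\1 - projv W)%VF.
have fE x : f x = x - projv W x by rewrite add_lfunE opp_lfunE id_lfunE.
have fv : f v != 0.
  by apply: contra vW; rewrite fE subr_eq0 => /eqP->; apply: memv_proj.
have [i ci] : exists i, coord (vbasis {:V}) i (f v) != 0.
  apply/existsP; apply: contraNT fv; rewrite negb_exists => /forallP c0.
  rewrite (coord_vbasis (memvf (f v))) big1 // => i _.
  by have /negPn/eqP-> := c0 i; rewrite scale0r.
have [|xi xiE] := @lfun_ex V K^o (fun v => coord (vbasis {:V}) i v).
  by move=> c x y; rewrite linearP.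
exists (xi \o f)%VF; split; first by rewrite comp_lfunE xiE.
by move=> w wW; rewrite comp_lfunE fE projv_id // subrr linear0.
Qed.

Lemma precomp_linear M N Y (f : rhom M N) : linear (fun h : rhom N Y => rhom_comp h f).
Proof. by move=> c g h; apply: rhomP => x; rewrite rhomDZE !rhom_compE rhomDZE. Qed.
(** [Hom(f, Y)], packed as a [K]-linear map so that the dimension of its image can be maximised and
    compared. *)
Definition precomp M N Y (f : rhom M N) : 'Hom(rhom N Y, rhom M Y) :=
  sval (cid (lfun_ex (@precomp_linear M N Y f))).
Lemma precompE M N Y (f : rhom M N) (h : rhom N Y) : precomp Y f h = rhom_comp h f.
Proof. exact: (svalP (cid (lfun_ex (@precomp_linear M N Y f)))). Qed.

Lemma postcomp_linear M N L (f : rhom M N) : linear (fun h : rhom L M => rhom_comp f h).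
Proof.
by move=> c g h; apply: rhomP => x; rewrite rhomDZE !rhom_compE rhomDZE linearP.
Qed.
Definition postcomp M N L (f : rhom M N) : 'Hom(rhom L M, rhom L N) :=
  sval (cid (lfun_ex (@postcomp_linear M N L f))).
Lemma postcompE M N L (f : rhom M N) (h : rhom L M) : postcomp L f h = rhom_comp f h.
Proof. exact: (svalP (cid (lfun_ex (@postcomp_linear M N L f)))). Qed.

Lemma rhom_sumE M N I (s : seq I) (F : I -> rhom M N) x :
  rhom_lfun (\sum_(i <- s) F i) x = \sum_(i <- s) F i x.
Proof.
elim: s => [|i s IHs]; first by rewrite !big_nil rhomD0.
by rewrite !big_cons rhomDE IHs.
Qed.

Lemma ract_reg a (b : reg) : ract reg a b = (b : A) * a.
Proof. exact: lfunE. Qed.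

Lemma reg_map_ex X (x : X) : exists f : rhom reg X, forall a, f a = ract X a x.
Proof.
apply: rhom_ex => [c a b|a b]; first by rewrite ractD ractZ.
by rewrite ract_reg ractMx.
Qed.
Definition reg_map X (x : X) : rhom reg X := sval (cid (reg_map_ex x)).
Lemma reg_mapE X (x : X) a : reg_map x a = ract X a x.
Proof. exact: (svalP (cid (reg_map_ex x))). Qed.

Lemma reg_hom X (g : rhom reg X) a : g a = ract X a (g (1 : A)).
Proof. by rewrite -rhomA ract_reg mul1r. Qed.

Lemma proj_lift P X Y (e : rhom X Y) (g : rhom P Y) : rprojective P -> repi e ->
  exists h : rhom P X, forall x, e (h x) = g x.
Proof.
by move=> Pp e1; have [h hE] := Pp _ _ e g e1; exists h => x; rewrite -hE rhom_compE.
Qed.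

Lemma rprojectiveI P : (forall X Y (e : rhom X Y) (g : rhom P Y), repi e ->
  exists h : rhom P X, forall x, e (h x) = g x) -> rprojective P.
Proof.
move=> H X Y e g /(H _ _ e g)[h hE]; exists h; apply: rhomP => x.
by rewrite rhom_compE.
Qed.

Lemma rprojective_reg : rprojective reg.
Proof.
apply: rprojectiveI => X Y e g /repiP/(_ (g (1 : A)))[x ex].
by exists (reg_map x) => a; rewrite reg_mapE rhomA ex [RHS]reg_hom.
Qed.

Lemma rprojective0 : rprojective (rmod0 A).
Proof.
apply: rprojectiveI => X Y e g _; exists 0 => x.
by rewrite (rmod0_zero x) !linear0.
Qed.

Lemma rprojective_dsum P Q : rprojective P -> rprojective Q -> rprojective (dsum P Q).
Proof.
move=> Pp Qp; apply: rprojectiveI => X Y e g e1.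
have [i iE] := inl_ex P Q; have [j jE] := inr_ex P Q.
have [h hE] := proj_lift (rhom_comp g i) Pp e1.
have [k kE] := proj_lift (rhom_comp g j) Qp e1.
have [m mE] := copair_ex h k; exists m => -[x y].
rewrite mE linearD /= hE kE !rhom_compE iE jE -linearD; congr (g _).
by congr pair; rewrite /= ?addr0 ?add0r.
Qed.

Lemma rprojective_dsummand P Q : dsummand P Q -> rprojective Q -> rprojective P.
Proof.
move=> /dsummandP[s [r rs]] Qp; apply: rprojectiveI => X Y e g e1.
have [h hE] := proj_lift (rhom_comp g r) Qp e1.
by exists (rhom_comp h s) => x; rewrite rhom_compE hE rhom_compE rs.
Qed.

Lemma rprojective_dsums I (F : I -> rmod A) (s : seq I) :
  (forall i, rprojective (F i)) -> rprojective (dsums [seq F i | i <- s]).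
Proof.
move=> Fp; elim: s => [|i s IHs]; first exact: rprojective0.
exact: rprojective_dsum.
Qed.

Lemma rprojective_free n : rprojective (dsums (nseq n reg)).
Proof.
elim: n => [|n IHn]; first exact: rprojective0.
exact: rprojective_dsum rprojective_reg IHn.
Qed.

(** A map from a free module with image of maximal dimension is onto: for [y] outside the image, one
    more copy of [A] with [1] sent to [y] would enlarge it. *)
Lemma free_cover M : exists n (e : rhom (dsums (nseq n reg)) M), repi e.
Proof.
pose T := {n & rhom (dsums (nseq n reg)) M}.
have [|t _|[n e] _ emax] := @ex_maxdim T (fun=> True) (fun t => \dim (limg (tagged t))) (mdim M).
- by exists (Tagged (fun n => rhom (dsums (nseq n reg)) M) (0 : rhom (dsums (nseq 0 reg)) M)).
- by rewrite dimvS ?subvf.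
exists n, e; apply/repiP => y; apply: contrapT => yN.
have [e' e'E] := copair_ex (reg_map y) e.
have e'im : (limg e <= limg e')%VS.
  apply/subvP => _ /rimP[x <-]; apply/rimP; exists (0, x).
  by rewrite e'E /= linear0 add0r.
have := emax (Tagged (fun n => rhom (dsums (nseq n reg)) M) (e' : rhom (dsums (nseq n.+1 reg)) M)) I.
rewrite /= => dle.
have /eqP imE : limg e == limg e' by rewrite eqEdim e'im.
apply: yN; apply/rimP; rewrite imE; apply/rimP; exists ((1 : A), 0).
by rewrite e'E /= linear0 addr0 reg_mapE ract1x.
Qed.

Lemma proj_dsummand_free P : rprojective P -> exists n, dsummand P (dsums (nseq n reg)).
Proof.
move=> Pp; have [n [e e1]] := free_cover P.
have [s sE] := proj_lift (rid P) Pp e1.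
by exists n; apply/dsummandP; exists s, e => x; rewrite sE ridE.
Qed.

(** Membership of [e] in the image of the canonical map from the tensor product of [L] and
    [Hom(P, A)] over [A] to [Hom(P, L)]. For the identity of [P] this is a dual basis. *)
Definition coordinatized P L (e : rhom P L) :=
  exists s : seq (L * rhom P reg), forall z, e z = \sum_(u <- s) ract L (u.2 z) u.1.

Lemma coordinatized_comp P Q L (e : rhom P L) (f : rhom Q P) :
  coordinatized e -> coordinatized (rhom_comp e f).
Proof.
move=> [s sE]; exists [seq (u.1, rhom_comp u.2 f) | u <- s] => z.
rewrite rhom_compE sE big_map; apply: eq_bigr => u _.
by congr (ract L _ _); rewrite -rhom_compE.
Qed.

Lemma coordinatized_add P L (e f : rhom P L) :
  coordinatized e -> coordinatized f -> coordinatized (e + f).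
Proof.
by move=> [s sE] [t tE]; exists (s ++ t) => z; rewrite rhomDE sE tE big_cat.
Qed.

Lemma coordinatized_reg L (e : rhom reg L) : coordinatized e.
Proof.
exists [:: (e (1 : A), rid reg)] => z.
by rewrite big_seq1 reg_hom; congr (ract L _ _); rewrite [RHS]ridE.
Qed.

Lemma dsum_hom_ex M N L (e : rhom (dsum M N) L) :
  exists (f : rhom M L) (g : rhom N L) (p : rhom (dsum M N) M) (q : rhom (dsum M N) N),
    e = rhom_comp f p + rhom_comp g q.
Proof.
have [i iE] := inl_ex M N; have [j jE] := inr_ex M N.
have [p pE] := fst_ex M N; have [q qE] := snd_ex M N.
exists (rhom_comp e i), (rhom_comp e j), p, q.
apply: rhomP => -[x y]; rewrite rhomDE !rhom_compE pE qE iE jE -linearD.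
by congr (e _); congr pair; rewrite /= ?addr0 ?add0r.
Qed.

Lemma dsums_cons X (s : seq (rmod A)) : dsums (X :: s) = dsum X (dsums s).
Proof. by []. Qed.

Lemma free_coord n L (e : rhom (dsums (nseq n reg)) L) : coordinatized e.
Proof.
elim: n e => [|n IHn].
  by move=> e; exists [::] => z; rewrite (rmod0_zero z) linear0 big_nil.
rewrite [nseq n.+1 reg]/= dsums_cons => e.
have [f [g [p [q ->]]]] := dsum_hom_ex e.
apply: coordinatized_add; apply: coordinatized_comp; last exact: IHn.
exact: coordinatized_reg.
Qed.

Lemma dual_basis P : rprojective P ->
  exists s : seq (P * rhom P reg), forall y, y = \sum_(u <- s) ract P (u.2 y) u.1.
Proof.
move=> /proj_dsummand_free[n /dsummandP[i [r ri]]].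
have [s sE] := coordinatized_comp i (free_coord r).
by exists s => y; rewrite -sE rhom_compE ri.
Qed.

Lemma dual_basis_hom P X (s : seq (P * rhom P reg)) (h : rhom P X) :
    (forall y, y = \sum_(u <- s) ract P (u.2 y) u.1) ->
  forall y, h y = \sum_(u <- s) ract X (u.2 y) (h u.1).
Proof.
move=> sE y; rewrite {1}(sE y) linear_sum.
by apply: eq_bigr => u _; rewrite /= rhomA.
Qed.

Lemma rker_incl_ex M N (f : rhom M N) : exists i : rhom (rker f) M,
  rmono i /\ forall y, f y = 0 <-> exists x, i x = y.
Proof.
have [c x y|a x|i iE] := @rhom_ex K A (rker f) M (fun x => vsval (x : subvs_of (lker f))).
- by rewrite linearP.
- by rewrite lfunE.
exists i; split; first by apply/rmonoP => x; rewrite iE => x0; apply: val_inj.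
move=> y; split=> [fy|[x <-]].
  have yk : y \in lker f by rewrite memv_ker fy.
  by exists (Subvs yk); rewrite iE.
by rewrite iE; apply/eqP; rewrite -memv_ker subvsP.
Qed.

(* [Hom(X, nu P)] is the dual of [Hom(P, X)] for [P] projective. *)
Lemma hom0_ker_nakayama P1 P0 (p1 : rhom P1 P0) X :
    rprojective P1 -> rprojective P0 ->
  hom0 X (rker (nakayama_map p1)) <->
  forall h : rhom P1 X, exists k : rhom P0 X, forall x, h x = k (p1 x).
Proof.
move=> P1p P0p; have [i [i0 iE]] := rker_incl_ex (nakayama_map p1).
have nuE (phi : nakayama P1) h : (nakayama_map p1 phi : 'Hom(rhom P0 reg, K^o)) h
    = (phi : 'Hom(rhom P1 reg, K^o)) (rhom_comp h p1).
  by rewrite -nakayama_funE /rhom_lfun /= (lfunE (nakayama_fun p1)).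
split=> [X0 h0|fac].
  apply: contrapT => noK.
  (* A functional [xi] separates [h0] from the maps that factor through [p1]. Under the duality [xi]
     becomes a map [phi] from [X] to [nu P1] that is killed by [nu p1]. *)
  have /functional_ex[xi [xi0 xiW]] : h0 \notin limg (precomp X p1).
    apply/negP => /memv_imgP[k _ hk]; apply: noK; exists k => x.
    by rewrite hk precompE rhom_compE.
  have [c x y|a x|phi phiE] := @rhom_ex K A X (nakayama P1)
      (fun x => (xi \o postcomp P1 (reg_map x))%VF).
  - apply/lfunP => h; rewrite add_lfunE scale_lfunE !comp_lfunE !postcompE -linearP.
    congr (xi _); apply: rhomP => z.
    by rewrite rhomDZE !rhom_compE !reg_mapE linearP.
  - rewrite ract_nakayamaE; apply/lfunP => h; rewrite nakayama_actE !comp_lfunE !postcompE.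
    congr (xi _); apply: rhomP => z.
    by rewrite !rhom_compE !reg_mapE lscaleE ractMx.
  have phi0 x : phi x = 0.
    have [psi psiE] : exists psi : rhom X (rker (nakayama_map p1)), forall x, i (psi x) = phi x.
      apply: mono_factor => // z; apply/iE; apply/lfunP => h.
      rewrite nuE zero_lfunE phiE comp_lfunE postcompE xiW //.
      apply/memv_imgP; exists (rhom_comp (reg_map z) h); first exact: memvf.
      by rewrite precompE; apply: rhomP => y; rewrite !rhom_compE.
    by rewrite -psiE (iffLR (hom0P _ _) X0) linear0.
  have [s sE] := dual_basis P1p.
  case/eqP: xi0.
  (* The dual basis writes [h0] as a sum of maps that factor through [A]. On such maps [xi] is a
     value of [phi], hence zero. *)
  have -> : h0 = \sum_(u <- s) rhom_comp (reg_map (h0 u.1)) u.2.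
    apply: rhomP => y; rewrite rhom_sumE (dual_basis_hom h0 sE).
    by apply: eq_bigr => u _; rewrite rhom_compE reg_mapE.
  rewrite linear_sum big1 // => u _.
  have := phi0 (h0 u.1); rewrite phiE => /lfunP/(_ u.2).
  by rewrite comp_lfunE postcompE zero_lfunE.
apply/hom0P => phi x; apply: (rmono_inj i0); rewrite linear0.
have [s sE] := dual_basis P1p; have [t tE] := dual_basis P0p.
(* Evaluation at any [h] becomes evaluation at the fixed dual basis of [P1], with [h] absorbed into
   the point of [X]. It is read forwards for [h] and backwards for the maps [rhom_comp u.2 p1],
   where the kernel condition gives zero. *)
have key z (h : rhom P1 reg) : (i (phi z) : 'Hom(rhom P1 reg, K^o)) h =
    \sum_(v <- s) (i (phi (ract X (h v.1) z)) : 'Hom(rhom P1 reg, K^o)) v.2.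
  under eq_bigr do rewrite !rhomA ract_nakayamaE nakayama_actE.
  rewrite -linear_sum; congr ((_ : 'Hom(_, _)) _); apply: rhomP => y.
  rewrite rhom_sumE (dual_basis_hom h sE y).
  by apply: eq_bigr => u _; rewrite lscaleE ract_reg.
suff H (h : rhom P1 reg) : (i (phi x) : 'Hom(rhom P1 reg, K^o)) h = 0.
  by apply/lfunP => h; rewrite zero_lfunE; apply: H.
rewrite key.
have [k kE] := fac (rhom_comp (reg_map x) h).
under eq_bigr => v _.
  have -> : ract X (h v.1) x = \sum_(u <- t) ract X ((rhom_comp u.2 p1) v.1) (k u.1).
    rewrite -reg_mapE -rhom_compE kE (dual_basis_hom k tE).
    by apply: eq_bigr => u _; rewrite rhom_compE.
  rewrite !linear_sum sum_lfunE.
  over.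
rewrite exchange_big big1 //= => u _.
apply: etrans (esym (key (k u.1) (rhom_comp u.2 p1))) _; rewrite -nuE.
by rewrite (iE (i (phi (k u.1)))).2 ?zero_lfunE //; exists (phi (k u.1)).
Qed.

(** * Projective covers and minimal presentations *)

Lemma superfluousI M (V : {vspace M}) :
    (forall L (i : rhom L M), rmono i ->
      (forall y, exists x, y - i x \in V) -> repi i) ->
  superfluous V.
Proof.
move=> H L sL LV; have [X [i [i0 iE]]] := sub_ex sL.
rewrite -iE; apply: H => // y.
have /memv_addP[u uL [v vV ->]] : y \in (L + V)%VS by rewrite LV memvf.
move: uL; rewrite -iE => /rimP[x ix]; exists x.
by rewrite ix addrC addKr.
Qed.

Lemma superfluousE M (V : {vspace M}) L (i : rhom L M) : superfluous V ->
  (forall y, exists x, y - i x \in V) -> repi i.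
Proof.
move=> sV H; apply: sV; first exact: submodule_im.
apply/vspaceP => y; rewrite memvf; have [x xV] := H y.
by rewrite -[y](subrK (i x)) addrC memv_add //; apply/rimP; exists x.
Qed.

Lemma iter_ex M (c : rhom M M) k : exists f : rhom M M, forall x, f x = iter k c x.
Proof.
elim: k => [|k [f fE]]; first by exists (rid M) => x; rewrite ridE.
by exists (rhom_comp c f) => x; rewrite rhom_compE fE.
Qed.

(** [X] is the image of a power of [c], chosen of minimal dimension. Applying the power again cannot
    shrink it, so the power is invertible on [X] and [X] splits off [M]. The exponent [k.+1] is
    positive, so the power vanishes wherever [c] does. *)
Lemma fitting M (c : rhom M M) : exists k X (q : rhom M X) (j : rhom X M),
  [/\ repi q, rmono j, forall x, j (q x) = iter k.+1 c x & rmono (rhom_comp q j)].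
Proof.
have [|[k f] fE0 fmin] := @ex_mindim (nat * rhom M M)
    (fun t => forall x, t.2 x = iter t.1.+1 c x) (fun t => \dim (limg t.2)).
  by have [f fE] := iter_ex c 1; exists (0%N, f).
have fE x : f x = iter k.+1 c x := fE0 x.
have [X [q [j [q1 j0 jE]]]] := im_ex f.
exists k, X, q, j; split=> // [x|]; first by rewrite jE fE.
apply: repi_mono_dim => //.
have le : (\dim (limg f) <= \dim (limg (rhom_comp f f)))%N.
  (* The first component is one less than the exponent, here twice [k.+1]. *)
  apply: (fmin ((k + k.+1)%N, rhom_comp f f)) => x.
  by rewrite rhom_compE !fE -iterD addSn.
have /eqP imE : limg (rhom_comp f f) == limg f.
  rewrite eqEdim le andbT; apply/subvP => _ /rimP[x <-]; rewrite rhom_compE.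
  by apply/rimP; exists (f x).
apply/repiP => y; have [z zy] := (repiP q).1 q1 y.
have : j y \in limg f by rewrite -zy jE; apply/rimP; exists z.
rewrite -imE => /rimP[w]; rewrite rhom_compE -2!jE => /(rmono_inj j0) wy.
by exists (q w); rewrite rhom_compE.
Qed.

(** Take a projective of minimal dimension that maps onto [M]. If [L] covers [P] modulo the kernel,
    lifting [p] through [L] gives an endomorphism of [P] over [M]. Fitting's lemma splits off a
    projective that still maps onto [M]; by minimality it is all of [P], so the endomorphism is
    injective and [L] is as large as [P]. *)
Lemma projective_cover M : exists P (p : rhom P M),
  [/\ rprojective P, repi p & superfluous (lker p)].
Proof.
pose T := {P & rhom P M}.
have [|[P p] [/= Pp p1] pmin] := @ex_mindim T
  (fun t => rprojective (tag t) /\ repi (tagged t)) (fun t => mdim (tag t)).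
  have [n [e e1]] := free_cover M.
  exists (Tagged (fun P => rhom P M) e); split=> //; exact: rprojective_free.
exists P, p; split=> //; apply: superfluousI => L i i0 iE.
have p2 : repi (rhom_comp p i).
  apply/repiP => z; have [y <-] := (repiP p).1 p1 z.
  have [x] := iE y; rewrite memv_ker linearB /= subr_eq0 => /eqP yx.
  by exists x; rewrite rhom_compE.
have [h hE] := proj_lift p Pp p2.
have [k [X [q [j [q1 j0 jE qj0]]]]] := fitting (rhom_comp i h).
have pjq x : p (j (q x)) = p x.
  rewrite jE; elim: (k.+1) => // n IHn.
  by rewrite iterS rhom_compE -(rhom_compE p i) hE IHn.
have dX : (mdim P <= mdim X)%N.
  apply: (pmin (Tagged (fun P => rhom P M) (rhom_comp p j))); split=> /=.
    exact: rprojective_dsummand (retract_dsummand qj0) Pp.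
  apply/repiP => z; have [y <-] := (repiP p).1 p1 z.
  by exists (q y); rewrite rhom_compE pjq.
have q0 := repi_mono_dim q1 dX.
apply: rmono_epi_dim => //.
have /rmonoP ih0 : rmono (rhom_comp i h).
  apply/rmonoP => x ihx; apply: (rmono_inj q0); apply: (rmono_inj j0).
  by rewrite jE iterSr ihx !linear0; elim: (k) => // n IHn; rewrite iterS IHn linear0.
rewrite (rmono_dim (f := h)) //; apply/rmonoP => x hx; apply: ih0.
by rewrite rhom_compE hx linear0.
Qed.

Lemma min_proj_presentation M : exists P1 P0 (p1 : rhom P1 P0) (p0 : rhom P0 M),
  minimal_projective_presentation p1 p0.
Proof.
have [P0 [p0 [P0p p0e p0s]]] := projective_cover M.
have [L [i [i0 iE]]] := ker_ex p0.
have [P1 [p [P1p pe ps]]] := projective_cover L.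
have kE : lker (rhom_comp i p) = lker p.
  apply/vspaceP => x; rewrite !memv_ker rhom_compE.
  by apply/eqP/eqP => [/((rmonoP i).1 i0)|->] //; rewrite linear0.
exists P1, P0, (rhom_comp i p), p0; split=> //; last by rewrite kE.
rewrite -iE; apply/vspaceP => y; apply/idP/idP => /rimP[x <-]; apply/rimP.
  by exists (p x); rewrite rhom_compE.
by have [z <-] := (repiP p).1 pe x; exists z; rewrite rhom_compE.
Qed.

Lemma tauP M : is_tau M (tau M).
Proof.
rewrite /tau; case: pselect => [H|[]]; first exact: (svalP (cid H)).
have [P1 [P0 [p1 [p0 H]]]] := min_proj_presentation M.
by exists (rker (nakayama_map p1)), P1, P0, p1, p0.
Qed.

(** All later information specific to [tau M] comes from this criterion. *)
Lemma tau_presentation M : exists P1 P0 (p1 : rhom P1 P0) (p0 : rhom P0 M),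
  minimal_projective_presentation p1 p0 /\
  forall X, hom0 X (tau M) <->
    forall h : rhom P1 X, exists k : rhom P0 X, forall x, h x = k (p1 x).
Proof.
have [P1 [P0 [p1 [p0 [H ->]]]]] := tauP M; exists P1, P0, p1, p0; split=> // X.
by case: H => P1p P0p _ _ _; apply: hom0_ker_nakayama.
Qed.

(** Lift [g] to [P0]. Along [p1] the lift lands in [X], and this part extends over [P0] by the
    criterion; after subtracting it, the lift descends to [M]. *)
Lemma hom0_tau_lift M X E C (f : rhom X E) (e : rhom E C) (g : rhom M C) :
  hom0 X (tau M) -> short_exact f e -> exists h : rhom M E, forall x, e (h x) = g x.
Proof.
have [P1 [P0 [p1 [p0 [[P1p P0p p0e /exactP pE _] tE]]]]] := tau_presentation M.
move=> /tE fac /short_exactP[f0 e1 feE].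
have [l lE] := proj_lift (rhom_comp g p0) P0p e1.
have [d dE] : exists d : rhom P1 X, forall x, f (d x) = rhom_comp l p1 x.
  apply: mono_factor => // x; apply/feE; rewrite rhom_compE lE rhom_compE.
  by rewrite (pE _).2 ?linear0 //; exists x.
have [k kE] := fac d.
have [|h hE] := epi_factor (f := l - rhom_comp f k) p0e.
  move=> _ /pE[x <-]; rewrite rhomBE rhom_compE -kE dE rhom_compE subrr //.
exists h => x; have [y <-] := (repiP p0).1 p0e x.
rewrite hE rhomBE linearB /= lE rhom_compE rhom_compE.
by rewrite (feE (f (k y))).2 ?subr0 //; exists (k y).
Qed.

(** [Ext^1(M, X) = 0] for all [X] in [T]: only the kernel of the sequence is constrained, while [E]
    and [C] are arbitrary. *)
Definition ext_projective (T : subcat A) M := forall X E C (f : rhom X E) (e : rhom E C),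
  short_exact f e -> T X -> forall g : rhom M C, exists h : rhom M E, forall x, e (h x) = g x.

Definition quot_closed (T : subcat A) := forall X Y (p : rhom X Y), repi p -> T X -> T Y.

Lemma pushout_ex M X L P (i : rhom L P) (p : rhom P M) (t : rhom L X) :
    short_exact i p ->
  exists E (f : rhom X E) (e : rhom E M) (b : rhom P E),
    [/\ short_exact f e, forall x, e (b x) = p x, forall x, b (i x) = f (t x) &
        forall N (g : rhom X N) (h : rhom P N), (forall x, h (i x) = g (t x)) ->
          exists k : rhom E N, (forall x, k (f x) = g x) /\ (forall x, k (b x) = h x)].
Proof.
move=> /short_exactP[i0 p1 ipE].
have [u uE] := pair_ex t (- i).
have [E [w [w1 /exactP uwE]]] := coker_ex u.
have [a aE] := inl_ex X P; have [b bE] := inr_ex X P.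
have [q qE] := snd_ex X P.
have [|e eE] := epi_factor (f := rhom_comp p q) w1.
  move=> _ /uwE[z <-]; rewrite uE rhom_compE qE /= rhomNE linearN /=.
  by rewrite (ipE _).2 ?oppr0 //; exists z.
have wz z : w (b (i z)) = w (a (t z)).
  apply/eqP; rewrite -subr_eq0 -linearB; apply/eqP/uwE; exists (- z).
  rewrite uE aE bE !linearN /= rhomNE opprK; congr pair; rewrite /= ?sub0r ?subr0 //.
exists E, (rhom_comp w a), e, (rhom_comp w b); split.
- apply/short_exactP; split.
  + apply/rmonoP => x; rewrite rhom_compE => /uwE[z].
    rewrite uE aE => -[<-]; rewrite rhomNE => /eqP.
    by rewrite oppr_eq0 => /eqP/((rmonoP i).1 i0)->; rewrite linear0.
  + apply/repiP => m; have [y <-] := (repiP p).1 p1 m.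
    by exists (w (b y)); rewrite eE bE rhom_compE qE.
  + move=> y; split; last first.
      by case=> x <-; rewrite rhom_compE eE aE rhom_compE qE /= linear0.
    have [[x y0] <-] := (repiP w).1 w1 y; rewrite eE rhom_compE qE /= => /ipE[z zy].
    exists (x + t z); rewrite rhom_compE linearD linearD /= -wz zy -linearD.
    by congr (w _); rewrite aE bE; congr pair; rewrite /= ?addr0 ?add0r.
- by move=> x; rewrite rhom_compE eE bE rhom_compE qE.
- by move=> x; rewrite !rhom_compE wz.
move=> N g h ghE; have [c cE] := copair_ex g h.
have [|k kE] := epi_factor (f := c) w1.
  by move=> _ /uwE[z <-]; rewrite uE cE /= rhomNE linearN /= ghE subrr.
exists k; split=> x; rewrite rhom_compE kE cE ?aE ?bE /= linear0.
  by rewrite addr0.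
by rewrite add0r.
Qed.

(** The pushout of the sequence along [t] splits. Subtracting from [b] its part in the section
    leaves a map into [X] that extends [t]. *)
Lemma ext_projective_extend T M X L P0 (i : rhom L P0) (p : rhom P0 M) (t : rhom L X) :
    ext_projective T M -> T X -> short_exact i p ->
  exists k : rhom P0 X, forall x, k (i x) = t x.
Proof.
move=> Mp TX ip; have /short_exactP[_ _ ipE] := ip.
have [E [f [e [b [ex ebE biE _]]]]] := pushout_ex t ip.
have [s sE] := Mp _ _ _ _ _ ex TX (rid M).
have /short_exactP[f0 _ feE] := ex.
have [k kE] : exists k : rhom P0 X, forall x, f (k x) = rhom_lfun (b - rhom_comp s p) x.
  apply: mono_factor => // x; apply/feE.
  by rewrite rhomBE linearB /= rhom_compE sE ridE ebE subrr.
exists k => x; apply: (rmono_inj f0); rewrite kE rhomBE rhom_compE biE.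
by rewrite (ipE (i x)).2; [rewrite linear0 subr0 | exists x].
Qed.

Lemma simple_sub_ex X : ~ rzero X -> exists S (i : rhom S X),
  [/\ rmono i, ~ rzero S & forall L (j : rhom L S), rmono j -> ~ rzero L -> repi j].
Proof.
move=> X0; pose T := {S & rhom S X}.
have [|[S i] [/= i0 S0] Smin] := @ex_mindim T
  (fun t => rmono (tagged t) /\ ~ rzero (tag t)) (fun t => mdim (tag t)).
  exists (Tagged (fun S => rhom S X) (rid X)); split=> //=.
  by apply/rmonoP => x; rewrite ridE.
exists S, i; split=> // L j j0 L0; apply: rmono_epi_dim => //.
apply: (Smin (Tagged (fun S => rhom S X) (rhom_comp i j))); split=> //=.
exact: rmono_comp.
Qed.

(* Auslander-Smalo; by induction on [X], a map [P1 -> X] reduces to one with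
   simple image, and such a map kills the superfluous kernel of [p1]. *)
Lemma ext_projective_hom0_tau T M X : quot_closed T -> ext_projective T M -> T X ->
  hom0 X (tau M).
Proof.
move=> Tq Mp TX.
have [P1 [P0 [p1 [p0 [[P1p P0p p0e /exactP pE [_ p1s]] tE]]]]] := tau_presentation M.
apply/tE; have [n] := ubnP (mdim X); elim: n X TX => // n IHn X TX Xn h.
have [X0|X0] := pselect (rzero X).
  by exists 0 => x; rewrite rhomD0 (X0 (h x)).
have [S [i [i0 S0 Smin]]] := simple_sub_ex X0.
have [Y [q [q1 iqE]]] := coker_ex i.
have iq : short_exact i q by split.
have Yn : (mdim Y < n)%N.
  rewrite ltnS in Xn; apply: leq_trans Xn.
  rewrite (short_exact_dim iq) -[X in (X < _)%N]add0n ltn_add2r.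
  by rewrite lt0n; apply/eqP => /rzeroP.
have [k kE] := IHn Y (Tq _ _ _ q1 TX) Yn (rhom_comp q h).
have [k' k'E] := proj_lift k P0p q1.
have /exactP iqE' := iqE.
have [d dE] : exists d : rhom P1 S, forall x, i (d x) = rhom_lfun (h - rhom_comp k' p1) x.
  apply: mono_factor => // x; apply/iqE'.
  by rewrite rhomBE linearB /= rhom_compE k'E -kE rhom_compE subrr.
have [L [j [j0 jE]]] := ker_ex p1.
have dj x : d (j x) = 0.
  have [I [a [b [a1 b0 bE]]]] := im_ex (rhom_comp d j).
  have [I0|I0] := pselect (rzero I).
    by rewrite -rhom_compE -bE (I0 (a x)) linear0.
  have b1 := Smin _ _ b0 I0.
  have [D [c [c0 cE]]] := ker_ex d.
  have /repiP c1 : repi c.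
    apply: superfluousE p1s _ => y.
    have [w wy] := (repiP b).1 b1 (d y); have [z zw] := (repiP a).1 a1 w.
    have : y - j z \in limg c.
      by rewrite cE memv_ker linearB /= -rhom_compE -bE zw wy subrr.
    move=> /rimP[v vE]; exists v; rewrite vE opprB addrC subrK -jE.
    by apply/rimP; exists z.
  have [v <-] := c1 (j x).
  by apply/eqP; rewrite -memv_ker -cE; apply/rimP; exists v.
(* So [d] factors through the image of [p1], which is the kernel of [p0], and from there
   Ext-projectivity extends it to [P0]. *)
have [I [a [b [a1 b0 bE]]]] := im_ex p1.
have [|t tE'] := epi_factor (f := rhom_comp i d) a1.
  move=> x ax; have : x \in limg j by rewrite jE memv_ker -bE ax linear0.
  by case/rimP=> z <-; rewrite rhom_compE dj linear0.
have [|m mE] := @ext_projective_extend T M X I P0 b p0 t Mp TX.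
  apply/short_exactP; split=> // y; rewrite pE; split=> -[x <-].
    by exists (a x).
  by have [z <-] := (repiP a).1 a1 x; exists z.
exists (k' + m) => x; rewrite rhomDE -bE mE tE' rhom_compE dE bE rhomBE rhom_compE.
by rewrite addrC subrK.
Qed.

End Projectives.

(** * Torsion classes and approximations *)

Section Torsion.
Variables (K : fieldType) (A : falgType K).
Implicit Types (M N L X Y Z E C P U Q : rmod A) (S T G : subcat A).

Notation mdim M := (\dim {: rmod_car M}).

Definition ext_closed T := forall X E Y (f : rhom X E) (g : rhom E Y),
  short_exact f g -> T X -> T Y -> T E.

Lemma hom0_epi X Y N (e : rhom X Y) : repi e -> hom0 X N -> hom0 Y N.
Proof.
move=> /repiP e1 /hom0P X0; apply/hom0P => f y; have [x <-] := e1 y.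
by rewrite -rhom_compE X0.
Qed.

Lemma hom0_mono N X Y (i : rhom X Y) : rmono i -> hom0 N Y -> hom0 N X.
Proof.
move=> i0 /hom0P Y0; apply/hom0P => f x.
by apply: (rmono_inj i0); rewrite -rhom_compE Y0 linear0.
Qed.

Lemma hom0_ext_closedl N : ext_closed (fun X => hom0 X N).
Proof.
move=> X E Y f g /short_exactP[f0 g1 fgE] /hom0P X0 /hom0P Y0; apply/hom0P => h z.
have [|k kE] := epi_factor (f := h) g1; last by rewrite -kE Y0.
by move=> _ /fgE[x <-]; rewrite -rhom_compE X0.
Qed.

Lemma hom0_ext_closedr N : ext_closed (fun X => hom0 N X).
Proof.
move=> X E Y f g /short_exactP[f0 g1 fgE] /hom0P X0 /hom0P Y0; apply/hom0P => h z.
have [|k kE] := mono_factor (f := h) f0; last by rewrite -kE X0 linear0.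
by move=> x; apply/fgE; rewrite -rhom_compE Y0.
Qed.

Lemma rprojective_hom0_quot P : rprojective P -> quot_closed (fun X => hom0 P X).
Proof.
move=> Pp X Y p p1 /hom0P X0; apply/hom0P => f x.
by have [h <-] := proj_lift f Pp p1; rewrite X0 linear0.
Qed.

Lemma hom0_dsums I (F : I -> rmod A) (s : seq I) N :
  (forall i, hom0 (F i) N) -> hom0 (dsums [seq F i | i <- s]) N.
Proof.
move=> F0; elim: s => [|i s IHs].
  by apply/hom0P => f x; rewrite (rmod0_zero x) linear0.
rewrite map_cons dsums_cons; have [f [g fg]] := dsum_short_exact (F i) (dsums (map F s)).
exact: hom0_ext_closedl fg (F0 i) IHs.
Qed.

Lemma nseq_map n M : nseq n M = [seq M | _ <- nseq n tt].
Proof. by elim: n => //= n ->. Qed.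

Lemma quot_closed_iso T X Y : quot_closed T -> riso X Y -> T X -> T Y.
Proof. by move=> Tq [f [_ f1]]; apply: Tq f1. Qed.

Lemma ext_closed_dsum T X Y : ext_closed T -> T X -> T Y -> T (dsum X Y).
Proof. by move=> Te; have [f [g fg]] := dsum_short_exact X Y; apply: Te fg. Qed.

Lemma ext_closed_dsums T I (F : I -> rmod A) (s : seq I) : ext_closed T -> T (rmod0 A) ->
  (forall i, T (F i)) -> T (dsums [seq F i | i <- s]).
Proof.
by move=> Te T0 TF; elim: s => // i s IHs; apply: ext_closed_dsum.
Qed.

(** * Factor modules and torsion classes *)

Lemma FacP M N : Fac M N <-> exists n (e : rhom (dsums (nseq n M)) N), repi e.
Proof.
split=> [[X [[n /dsummandP[s [r rs]]] [f f1]]]|[n [e e1]]].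
  exists n, (rhom_comp f r); apply: repi_comp => //.
  by apply/repiP => x; exists (s x).
by exists (dsums (nseq n M)); split; [exists n; apply/riso_dsummand/riso_refl | exists e].
Qed.

Lemma Fac_quot M : quot_closed (Fac M).
Proof.
move=> X Y p p1 /FacP[n [e e1]]; apply/FacP; exists n, (rhom_comp p e).
exact: repi_comp.
Qed.

Lemma Fac_self M : Fac M M.
Proof.
apply/FacP; exists 1%N; have [p pE] := fst_ex M (rmod0 A); exists p.
by apply/repiP => x; exists (x, 0); rewrite pE.
Qed.

Lemma Fac0 M : Fac M (rmod0 A).
Proof.
by apply/FacP; exists 0%N, 0; apply/repiP => x; exists 0; rewrite linear0 (rmod0_zero x).
Qed.

Lemma Fac_dsum M X Y : Fac M X -> Fac M Y -> Fac M (dsum X Y).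
Proof.
move=> /FacP[m [e e1]] /FacP[n [f f1]]; apply/FacP; exists (m + n)%N.
rewrite nseqD.
have [g [_ g1]] := dsums_cat (nseq m M) (nseq n M).
have [p pE] := fst_ex (dsums (nseq m M)) (dsums (nseq n M)).
have [q qE] := snd_ex (dsums (nseq m M)) (dsums (nseq n M)).
have [h hE] := pair_ex (rhom_comp e p) (rhom_comp f q).
exists (rhom_comp h g); apply: repi_comp => //; apply/repiP => -[x y].
have [x' <-] := (repiP e).1 e1 x; have [y' <-] := (repiP f).1 f1 y.
by exists (x', y'); rewrite hE !rhom_compE pE qE.
Qed.

Lemma Fac_dsums M I (F : I -> rmod A) (s : seq I) : (forall i, Fac M (F i)) ->
  Fac M (dsums [seq F i | i <- s]).
Proof. by move=> MF; elim: s => [|i s IHs]; [apply: Fac0 | apply: Fac_dsum]. Qed.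

Lemma Fac_trans X M Y : Fac M X -> Fac X Y -> Fac M Y.
Proof.
move=> MX /FacP[n [e e1]]; apply: Fac_quot e1 _.
by rewrite nseq_map; apply: Fac_dsums.
Qed.

Lemma Fac_min T M : quot_closed T -> ext_closed T -> T (rmod0 A) -> T M -> Fac M `<=` T.
Proof.
move=> Tq Te T0 TM X /FacP[n [e e1]]; apply: Tq e1 _.
by rewrite nseq_map; apply: ext_closed_dsums.
Qed.

Lemma hom0_Facl M N X : Fac M X -> hom0 M N -> hom0 X N.
Proof.
by move=> /FacP[n [e e1]] M0; apply: hom0_epi e1 _; rewrite nseq_map; apply: hom0_dsums.
Qed.

Lemma ext_projective_dsum T M N :
  ext_projective T M -> ext_projective T N -> ext_projective T (dsum M N).
Proof.
move=> Mp Np X E C f e fe TX g; have [a [b [p [q ->]]]] := dsum_hom_ex g.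
have [h hE] := Mp _ _ _ _ _ fe TX a; have [k kE] := Np _ _ _ _ _ fe TX b.
exists (rhom_comp h p + rhom_comp k q) => x.
by rewrite !rhomDE linearD /= !rhom_compE hE kE.
Qed.

Lemma ext_projective0 T : ext_projective T (rmod0 A).
Proof.
move=> X E C f e _ _ g; exists 0 => x.
by rewrite (rmod0_zero x) !linear0.
Qed.

Lemma ext_projective_dsums T I (F : I -> rmod A) (s : seq I) :
  (forall i, ext_projective T (F i)) -> ext_projective T (dsums [seq F i | i <- s]).
Proof.
move=> Fp; elim: s => [|i s IHs]; first exact: ext_projective0.
exact: ext_projective_dsum.
Qed.

Lemma ext_projective_dsummand T M N :
  dsummand M N -> ext_projective T N -> ext_projective T M.
Proof.
move=> /dsummandP[s [r rs]] Np X E C f e fe TX g.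
have [h hE] := Np _ _ _ _ _ fe TX (rhom_comp g r).
by exists (rhom_comp h s) => x; rewrite rhom_compE hE rhom_compE rs.
Qed.

(** A cover of [Y] by copies of [M] lifts to [E], because [Ext^1(M, X) = 0] for [X] in [Fac M].
    Together with [X] the lift covers [E]. *)
Lemma tau_rigid_Fac_ext M : hom0 M (tau M) -> ext_closed (Fac M).
Proof.
move=> Mr X E Y f g fg MX /FacP[n [e e1]].
have Mp : ext_projective (Fac M) (dsums (nseq n M)).
  rewrite nseq_map; apply: ext_projective_dsums => _ X' E' C' f' e' fe' MX' g'.
  exact: hom0_tau_lift (hom0_Facl MX' Mr) fe'.
have [h hE] := Mp _ _ _ _ _ fg MX e.
have [c cE] := copair_ex f h; have /short_exactP[f0 g1 fgE] := fg.
apply: (@Fac_quot M _ _ c); last first.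
  by apply: Fac_dsum => //; apply/FacP; exists n, (rid _); apply/repiP => x; exists x; rewrite ridE.
apply/repiP => z; have [y yz] := (repiP e).1 e1 (g z).
have /fgE[x xz] : g (z - h y) = 0 by rewrite linearB /= hE yz subrr.
by exists (x, y); rewrite cE /= xz subrK.
Qed.

(* The torsion part of [X] is a subobject in [G] of maximal dimension. *)
Lemma torsion_part G X : ext_closed G -> G (rmod0 A) ->
  exists Xt Xf (i : rhom Xt X) (p : rhom X Xf),
    [/\ short_exact i p, G Xt & forall I (j : rhom I Xf), rmono j -> G I -> rzero I].
Proof.
move=> Ge G0; pose T := {Z & rhom Z X}.
have [||[Xt i] [/= i0 GXt] imax] := @ex_maxdim T
  (fun t => rmono (tagged t) /\ G (tag t)) (fun t => mdim (tag t)) (mdim X).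
- exists (Tagged (fun Z => rhom Z X) (0 : rhom (rmod0 A) X)); split=> //=.
  by apply/rmonoP => x _; apply: rmod0_zero.
- by move=> [Z s] /= [/rmono_dim].
have [Xf [p [p1 pE]]] := coker_ex i.
exists Xt, Xf, i, p; split=> // I j j0 GI.
have [Y [c [c1 cE]]] := coker_ex j.
(* [E] is the preimage of [I] in [X], an extension of [I] by [Xt]. It lies in [G], so maximality of
   [Xt] leaves no room for [I]. *)
have [E [k [k0 kE]]] := ker_ex (rhom_comp c p).
have /exactP ipE := pE; have /exactP jcE := cE.
have kker x : c (p (k x)) = 0.
  by rewrite -(rhom_compE c p); apply/eqP; rewrite -memv_ker -kE; apply/rimP; exists x.
have [r rE] : exists r : rhom E I, forall x, j (r x) = rhom_comp p k x.
  by apply: mono_factor => // x; apply/jcE; rewrite rhom_compE kker.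
have [i' i'E] : exists i' : rhom Xt E, forall x, k (i' x) = i x.
  apply: mono_factor => // x; apply/rimP; rewrite kE memv_ker rhom_compE.
  by rewrite (ipE (i x)).2 ?linear0 //; exists x.
have ex : short_exact i' r.
  apply/short_exactP; split.
  - by apply/rmonoP => x ix; apply: ((rmonoP i).1 i0); rewrite -i'E ix linear0.
  - apply/repiP => y; have [x xy] := (repiP p).1 p1 (j y).
    have : x \in limg k.
      by rewrite kE memv_ker rhom_compE xy (jcE (j y)).2 //; exists y.
    move=> /rimP[z zx]; exists z; apply: (rmono_inj j0).
    by rewrite rE rhom_compE zx xy.
  - move=> y; split=> [ry|[x <-]].
      have /ipE[x xy] : p (k y) = 0 by rewrite -rhom_compE -rE ry linear0.
      by exists x; apply: (rmono_inj k0); rewrite i'E.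
    apply: (rmono_inj j0); rewrite rE rhom_compE i'E linear0.
    by apply/ipE; exists x.
have := imax (Tagged (fun Z => rhom Z X) k) (conj k0 (Ge _ _ _ _ _ ex GXt GI)).
rewrite /= (short_exact_dim ex) -[X in (_ <= X)%N]addn0 leq_add2l leqn0 => /eqP dI.
exact/rzeroP.
Qed.

Lemma torsion_class_ext T : quot_closed T -> ext_closed T -> T (rmod0 A) ->
  torsion_class (@rmodT K A) T.
Proof.
move=> Tq Te T0; exists (fun Y => forall X, T X -> hom0 X Y); split.
- by split=> // X Y XY; apply: quot_closed_iso.
- split=> // Y Z /riso_sym [f [f0 _]] YF X TX; exact: hom0_mono f0 (YF X TX).
- by move=> X Y TX YF; apply: YF.
move=> X _; have [Xt [Xf [i [p [ip TXt Xf0]]]]] := torsion_part X Te T0.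
exists Xt, Xf, i, p; split=> // Z TZ; apply/hom0P => f z.
have [I [q [j [q1 j0 jE]]]] := im_ex f.
by rewrite -jE (Xf0 I j j0 (Tq _ _ _ q1 TZ) (q z)) linear0.
Qed.

Lemma torsion_class_right_approx S T X : torsion_class S T -> S X -> has_right_approx T X.
Proof.
move=> [F [_ _ TF0 part]] /part[Xt [Xf [i [p [TXt FXf /short_exactP[i0 p1 ipE]]]]]].
exists Xt, i; split=> // N g TN.
have [|h hE] := mono_factor (f := g) i0.
  by move=> x; apply/ipE; rewrite -rhom_compE (iffLR (hom0P _ _) (TF0 _ _ TN FXf)).
by exists h; apply: rhomP => x; rewrite rhom_compE.
Qed.

(** * Left approximations *)

Lemma has_left_approxP S X : has_left_approx S X <-> exists N (f : rhom X N),
  S N /\ forall N' (g : rhom X N'), S N' -> exists h : rhom N N', forall x, h (f x) = g x.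
Proof.
split=> -[N [f [SN fE]]]; exists N, f; split=> // N' g /(fE _ g)[h hE]; exists h.
  by move=> x; rewrite -hE rhom_compE.
by apply: rhomP => x; rewrite rhom_compE.
Qed.

(** Choose [f] with the largest image of [Hom(N, M)] in [Hom(P, M)]. Adding a map [g] as a further
    component enlarges nothing, so [g] factors through [f]. Powers of [M] follow componentwise, and
    their quotients by projectivity of [P]. *)
Lemma Fac_left_approx_proj M P : rprojective P -> exists N (f : rhom P N), Fac M N /\
  forall N' (g : rhom P N'), Fac M N' -> exists h : rhom N N', forall x, h (f x) = g x.
Proof.
move=> Pp; pose T := {N & rhom P N}.
have [|t _|[N f] /= MN fmax] := @ex_maxdim T (fun t => Fac M (tag t))
    (fun t => \dim (limg (precomp M (tagged t)))) (\dim {: rhom P M}).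
- exists (Tagged (fun N => rhom P N) (0 : rhom P (rmod0 A))); exact: Fac0.
- by rewrite dimvS ?subvf.
have H (g : rhom P M) : exists h : rhom N M, forall x, h (f x) = g x.
  have [f' f'E] := pair_ex g f.
  have [p pE] := fst_ex M N; have [q qE] := snd_ex M N.
  have fs : (limg (precomp M f) <= limg (precomp M f'))%VS.
    apply/subvP => _ /memv_imgP[h _ ->]; apply/memv_imgP; exists (rhom_comp h q).
      exact: memvf.
    by rewrite !precompE; apply: rhomP => x; rewrite !rhom_compE f'E qE.
  have dle : (\dim (limg (precomp M f')) <= \dim (limg (precomp M f)))%N.
    exact: (fmax (Tagged (fun N => rhom P N) f') (Fac_dsum (Fac_self M) MN)).
  have /eqP fE : limg (precomp M f) == limg (precomp M f') by rewrite eqEdim fs.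
  have : g \in limg (precomp M f).
    rewrite fE; apply/memv_imgP; exists p; first exact: memvf.
    by rewrite precompE; apply: rhomP => x; rewrite rhom_compE f'E pE.
  by move=> /memv_imgP[h _ ->]; exists h => x; rewrite precompE rhom_compE.
have H' m : forall g : rhom P (dsums (nseq m M)),
    exists h : rhom N (dsums (nseq m M)), forall x, h (f x) = g x.
  elim: m => [|m IHm]; first by move=> g; exists 0 => x; rewrite rhomD0 (rmod0_zero (g x)).
  rewrite [nseq m.+1 M]/= dsums_cons; move: (dsums _) IHm => Z IHZ g.
  have [p pE] := fst_ex M Z; have [q qE] := snd_ex M Z.
  have [h hE] := H (rhom_comp p g); have [k kE] := IHZ (rhom_comp q g).
  have [c cE] := pair_ex h k; exists c => x.
  by rewrite cE hE kE !rhom_compE pE qE; case: (g x).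
exists N, f; split=> // N' g /FacP[m [e e1]].
have [l lE] := proj_lift g Pp e1; have [h hE] := H' m l.
by exists (rhom_comp e h) => x; rewrite rhom_compE hE lE.
Qed.

(** Approximate a free cover of [X] and divide by the image of the kernel of the cover; [Fac M] is
    closed under quotients. *)
Lemma Fac_left_approx M X : has_left_approx (Fac M) X.
Proof.
apply/has_left_approxP; have [r [e e1]] := free_cover X.
have [Y [f [MY fE]]] := Fac_left_approx_proj M (@rprojective_free K A r).
have [L [i [i0 iE]]] := ker_ex e.
have [N [p [p1 /exactP pE]]] := coker_ex (rhom_comp f i).
have ie x : e (i x) = 0.
  by apply/eqP; rewrite -memv_ker -iE; apply/rimP; exists x.
have [|c cE] := epi_factor (f := rhom_comp p f) e1.
  move=> x ex; have /rimP[y <-] : x \in limg i by rewrite iE memv_ker ex.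
  by rewrite rhom_compE; apply/pE; exists y; rewrite rhom_compE.
exists N, c; split; first exact: Fac_quot p1 MY.
move=> N' g /(fE _ (rhom_comp g e))[h hE].
have [|k kE] := epi_factor (f := h) p1.
  by move=> _ /pE[x <-]; rewrite rhom_compE hE rhom_compE ie linear0.
exists k => x; have [y <-] := (repiP e).1 e1 x.
by rewrite cE rhom_compE kE hE rhom_compE.
Qed.

Lemma star_left_approx S T : (forall X, has_left_approx S X) ->
  (forall X, has_left_approx T X) -> forall X, has_left_approx (star S T) X.
Proof.
move=> Sa Ta C; apply/has_left_approxP.
have [Y [f [TY fE]]] := (has_left_approxP _ _).1 (Ta C).
have [r [q q1]] := free_cover Y; set P := dsums _ in q q1.
have [v vE] := copair_ex f q.
have v1 : repi v.
  apply/repiP => y; have [x <-] := (repiP q).1 q1 y.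
  by exists (0, x); rewrite vE /= linear0 add0r.
have [L [k [k0 kE]]] := ker_ex v.
have [X0 [a [SX0 aE]]] := (has_left_approxP _ _).1 (Sa L).
have kv : short_exact k v by [].
have [E [s [e [b [se ebE bkE Euni]]]]] := pushout_ex a kv.
have /short_exactP[_ _ kvE] := kv.
have [c cE] := inl_ex C P; have [d dE] := inr_ex C P.
exists E, (rhom_comp b c); split; first by exists X0, Y, s, e.
move=> N g [X' [Y' [x' [y' [SX' TY' /short_exactP[x'0 y'1 x'yE]]]]]].
have [m mE] := fE Y' (rhom_comp y' g) TY'.
have [l lE] := proj_lift (rhom_comp m q) (@rprojective_free K A r) y'1.
(* [w] lies over [m], so it carries the kernel [L] of [v] into [X']; there the approximation [a] of
   [L] takes over. *)
have [w wE] := copair_ex g l.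
have [t tE] : exists t : rhom L X', forall x, x' (t x) = rhom_comp w k x.
  apply: mono_factor => // x; apply/x'yE; rewrite rhom_compE wE linearD /= lE.
  rewrite -(rhom_compE y' g) -mE rhom_compE -linearD -vE.
  by rewrite (kvE (k x)).2 ?linear0 //; exists x.
have [t' t'E] := aE X' t SX'.
have [|h [hs hb]] := Euni N (rhom_comp x' t') w.
  by move=> x; rewrite rhom_compE t'E tE rhom_compE.
by exists h => x; rewrite rhom_compE hb wE cE /= linear0 addr0.
Qed.

End Torsion.

(** * Reduction at a tau-rigid pair *)

Section Reduction.
Variables (K : fieldType) (A : falgType K) (U Q M : rmod A).
Hypotheses (Ur : hom0 U (tau U)) (Qp : rprojective Q) (QU : hom0 Q U).
Hypothesis Mr : hom0 M (tau M).
Implicit Types (L N X Y Z E C P : rmod A).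

(** The upper end of the interval [tors U Q], whose lower end is [Fac U]. The wide subcategory is
    its [U]-torsion-free part. *)
Definition rtop : subcat A := lperp (tau U) `&` rperp Q.
Let W : subcat A := wide_of U Q.

Lemma wide_ofE X : W X <-> hom0 U X /\ rtop X.
Proof. by split=> [[[]]|[? []]]. Qed.

Lemma rtop_quot : quot_closed rtop.
Proof.
move=> X Y p p1 [Xt XQ]; split; first exact: hom0_epi p1 Xt.
exact: rprojective_hom0_quot p1 XQ.
Qed.

Lemma rtop_ext : ext_closed rtop.
Proof.
move=> X E Y f g fg [Xt XQ] [Yt YQ]; split.
  exact: hom0_ext_closedl fg Xt Yt.
exact: hom0_ext_closedr fg XQ YQ.
Qed.

Lemma hom00l N : hom0 (rmod0 A) N.
Proof. by apply/hom0P => f x; rewrite (rmod0_zero x) linear0. Qed.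

Lemma hom00r N : hom0 N (rmod0 A).
Proof. by apply/hom0P => f x; apply: rmod0_zero. Qed.

Lemma rtop0 : rtop (rmod0 A).
Proof. by split; [apply: hom00l | apply: hom00r]. Qed.

Lemma Fac_sub_rtop : Fac U `<=` rtop.
Proof. exact: Fac_min rtop_quot rtop_ext rtop0 (conj Ur QU). Qed.

Lemma torsion_part_Fac X : exists Xt Xf (i : rhom Xt X) (p : rhom X Xf),
  [/\ short_exact i p, Fac U Xt & hom0 U Xf].
Proof.
have [Xt [Xf [i [p [ip UXt Xf0]]]]] := torsion_part X (tau_rigid_Fac_ext Ur) (Fac0 U).
exists Xt, Xf, i, p; split=> //; apply/hom0P => f x.
have [I [q [j [q1 j0 jE]]]] := im_ex f.
by rewrite -jE (Xf0 I j j0 (Fac_quot q1 (Fac_self U)) (q x)) linear0.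
Qed.

Lemma short_exact_id X : exists (i : rhom (rmod0 A) X), short_exact i (rid X).
Proof.
exists 0; apply/short_exactP; split.
- by apply/rmonoP => x _; apply: rmod0_zero.
- by apply/repiP => x; exists x; rewrite ridE.
- move=> x; rewrite ridE; split=> [->|[y <-]]; first by exists 0; rewrite linear0.
  by rewrite rhomD0.
Qed.

Lemma short_exact_id0 X : exists (p : rhom X (rmod0 A)), short_exact (rid X) p.
Proof.
exists 0; apply/short_exactP; split.
- by apply/rmonoP => x; rewrite ridE.
- by apply/repiP => x; exists 0; rewrite linear0 (rmod0_zero x).
- by move=> x; rewrite rhomD0; split=> // _; exists x; rewrite ridE.
Qed.

Lemma wide_Fac_ext : ext_closed (W `&` Fac M).
Proof.
move=> X E Y f g fg [/wide_ofE[UX TX] MX] [/wide_ofE[UY TY] MY]; split.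
  by apply/wide_ofE; split; [apply: hom0_ext_closedr fg UX UY | apply: rtop_ext fg TX TY].
exact: tau_rigid_Fac_ext fg MX MY.
Qed.

Lemma wide_Fac0 : (W `&` Fac M) (rmod0 A).
Proof.
split; last exact: Fac0.
by apply/wide_ofE; split; [apply: hom00r | apply: rtop0].
Qed.

(** [Ext^1(U, L) = 0] makes every map from [U] to the cokernel lift to [X]. This keeps the quotients
    formed below [U]-torsion-free. *)
Lemma hom0_coker L X C (f : rhom L X) (p : rhom X C) : short_exact f p ->
  rtop L -> hom0 U X -> hom0 U C.
Proof.
move=> fp [Lt _] /hom0P UX; apply/hom0P => g x.
by have [h <-] := hom0_tau_lift g Lt fp; rewrite UX linear0.
Qed.

Lemma wide_iso : iso_closed W.
Proof.
move=> X Y XY /wide_ofE[UX TX]; apply/wide_ofE; split.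
  by have [f [f0 _]] := riso_sym XY; apply: hom0_mono f0 UX.
exact: quot_closed_iso rtop_quot XY TX.
Qed.

(** The quotient [Xf] stays in [W] by [hom0_coker]. The image of a map to it from [Z] in the torsion
    class is again in the class: as a submodule of [Xf] it is [U]-torsion-free, as a quotient of [Z]
    it lies in [rtop] and in [Fac M]. *)
Lemma wide_Fac_torsion : torsion_class W (W `&` Fac M).
Proof.
exists (fun Y => W Y /\ forall X, (W `&` Fac M) X -> hom0 X Y); split.
- split=> [X Y XY [WX MX]|X []//]; split; first exact: wide_iso XY WX.
  exact: quot_closed_iso (@Fac_quot K A M) XY MX.
- split=> [Y Z YZ [WY F0]|X []//]; split; first exact: wide_iso YZ WY.
  by have [f [f0 _]] := riso_sym YZ => X GX; apply: hom0_mono f0 (F0 X GX).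
- by move=> X Y GX [_]; apply.
move=> X /wide_ofE[UX TX].
have [Xt [Xf [i [p [ip [/wide_ofE[UXt TXt] MXt] Xf0]]]]] := torsion_part X wide_Fac_ext wide_Fac0.
have UXf : hom0 U Xf by apply: hom0_coker ip TXt UX.
have [_ _ p1] := ip.
have WXf : W Xf by apply/wide_ofE; split=> //; apply: rtop_quot p1 TX.
exists Xt, Xf, i, p; split=> //.
  by split=> //; apply/wide_ofE.
split=> // Z [/wide_ofE[UZ TZ] MZ]; apply/hom0P => f z.
have [I [q [j [q1 j0 jE]]]] := im_ex f.
have GI : (W `&` Fac M) I.
  split; last exact: Fac_quot q1 MZ.
  apply/wide_ofE; split; [exact: hom0_mono j0 UXf | exact: rtop_quot q1 TZ].
by rewrite -jE (Xf0 I j j0 GI (q z)) linear0.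
Qed.

Let T : subcat A := star (Fac U) (W `&` Fac M).

Lemma starP X : T X <-> rtop X /\ exists Xt Xf (i : rhom Xt X) (p : rhom X Xf),
  [/\ short_exact i p, Fac U Xt, hom0 U Xf & Fac M Xf].
Proof.
split=> [[Xt [Xf [i [p [UXt [/wide_ofE[UXf TXf] MXf] ip]]]]]|].
  split; first exact: rtop_ext ip (Fac_sub_rtop UXt) TXf.
  by exists Xt, Xf, i, p.
move=> [TX [Xt [Xf [i [p [ip UXt UXf MXf]]]]]]; exists Xt, Xf, i, p; split=> //.
split=> //; apply/wide_ofE; split=> //; have [_ _ p1] := ip; exact: rtop_quot p1 TX.
Qed.

Lemma epi_right X Y Z (g : rhom Y Z) (f : rhom X Y) (h : rhom X Z) :
  (forall x, g (f x) = h x) -> repi h -> repi g.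
Proof.
by move=> gf /repiP h1; apply/repiP => z; have [x <-] := h1 z; exists (f x).
Qed.

(** A map to a [U]-torsion-free module kills [Xt], so [Z] is a quotient of [Xf]. *)
Lemma star_quot_Fac X Xt Xf (i : rhom Xt X) (p : rhom X Xf) Z (h : rhom X Z) :
  short_exact i p -> Fac U Xt -> Fac M Xf -> repi h -> hom0 U Z -> Fac M Z.
Proof.
move=> /short_exactP[i0 p1 ipE] UXt MXf h1 UZ.
have /hom0P XtZ := hom0_Facl UXt UZ.
have [|g gE] := epi_factor (f := h) p1.
  by move=> _ /ipE[x <-]; rewrite -rhom_compE XtZ.
exact: Fac_quot (epi_right gE h1) MXf.
Qed.

Lemma star_quot : quot_closed T.
Proof.
move=> X Z h h1 /starP[TX [Xt [Xf [i [p [ip UXt UXf MXf]]]]]]; apply/starP.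
split; first exact: rtop_quot h1 TX.
have [Zt [Zf [i' [p' [ip' UZt UZf]]]]] := torsion_part_Fac Z.
exists Zt, Zf, i', p'; split=> //; have [_ _ p'1] := ip'.
exact: star_quot_Fac ip UXt MXf (repi_comp p'1 h1) UZf.
Qed.

Lemma star_ext : ext_closed T.
Proof.
move=> X E Z f g fg /starP[TX [Xt [Xf [i [p [ip UXt UXf MXf]]]]]].
move=> /starP[TZ [Zt [Zf [i' [p' [ip' UZt UZf MZf]]]]]]; apply/starP.
split; first exact: rtop_ext fg TX TZ.
have [Et [Ef [k [r [kr UEt UEf]]]]] := torsion_part_Fac E.
exists Et, Ef, k, r; split=> //; have [_ _ r1] := kr.
(* The torsion-free part [Ef] is an extension of [D], a quotient of [Z], by [I], a quotient of [X].
   Both are [U]-torsion-free, [D] because [I] lies in [rtop]; hence both lie in [Fac M], which is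
   closed under extensions. *)
have [I [q [j [q1 j0 jE]]]] := im_ex (rhom_comp r f).
have [D [c [c1 jcE]]] := coker_ex j.
have jc : short_exact j c by [].
have MI : Fac M I := star_quot_Fac ip UXt MXf q1 (hom0_mono j0 UEf).
have UD : hom0 U D := hom0_coker jc (rtop_quot q1 TX) UEf.
have /short_exactP[f0 g1 fgE] := fg; have /short_exactP[_ _ jcE'] := jc.
have [|h hE] := epi_factor (f := rhom_comp c r) g1.
  move=> _ /fgE[x <-]; rewrite rhom_compE -(rhom_compE r f) -jE.
  by apply/jcE'; exists (q x).
have h1 : repi h by apply: epi_right hE _; apply: repi_comp.
exact: tau_rigid_Fac_ext jc MI (star_quot_Fac ip' UZt MZf h1 UD).
Qed.

Lemma star0 : T (rmod0 A).
Proof.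
have [i ex] := short_exact_id (rmod0 A).
by exists (rmod0 A), (rmod0 A), i, (rid _); split=> //; [apply: Fac0 | apply: wide_Fac0].
Qed.

Lemma star_tors : tors U Q T.
Proof.
split; first exact: torsion_class_ext star_quot star_ext star0.
  move=> X UX; have [p ex] := short_exact_id0 X.
  by exists X, (rmod0 A), (rid X), p; split=> //; apply: wide_Fac0.
by move=> X /starP[].
Qed.

(** Divide the target of a [Fac M]-approximation by its [U]-torsion part, which every map to a
    [U]-torsion-free module kills. *)
Lemma rperp_Fac_left_approx X : has_left_approx (rperp U `&` Fac M) X.
Proof.
have /has_left_approxP[N [f [MN fE]]] := Fac_left_approx M X.
have [Nt [Nf [i [p [ip UNt UNf]]]]] := torsion_part_Fac N.
have /short_exactP[i0 p1 ipE] := ip.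
apply/has_left_approxP; exists Nf, (rhom_comp p f).
split; first by split=> //; apply: Fac_quot p1 MN.
move=> N' g [UN' MN']; have [h hE] := fE N' g MN'.
have /hom0P NtN' := hom0_Facl UNt UN'.
have [|k kE] := epi_factor (f := h) p1.
  by move=> _ /ipE[x <-]; rewrite -rhom_compE NtN'.
by exists k => x; rewrite rhom_compE kE hE.
Qed.

Lemma rperp_Fac_rtop : rperp U `&` Fac M `<=` rtop -> Fac M `<=` rtop.
Proof.
move=> H X MX; have [Xt [Xf [i [p [ip UXt UXf]]]]] := torsion_part_Fac X.
have [_ _ p1] := ip; apply: rtop_ext ip (Fac_sub_rtop UXt) (H _ _).
by split=> //; apply: Fac_quot p1 MX.
Qed.

Lemma rperp_Fac_wide : Fac M `<=` rtop -> rperp U `&` Fac M `=` W `&` Fac M.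
Proof.
move=> H X; split=> [[UX MX]|[/wide_ofE[UX TX] MX]] //.
by split=> //; apply/wide_ofE; split=> //; apply: H.
Qed.

Lemma star_rperp_Fac : star (Fac U) (rperp U `&` Fac M) `=` star (Fac U) (Fac M).
Proof.
move=> X; split=> [[X1 [X2 [f [g [UX1 [_ MX2] fg]]]]]|]; first by exists X1, X2, f, g.
move=> [X1 [X2 [f [g [UX1 MX2 fg]]]]].
have [Xt [Xf [i [p [ip UXt UXf]]]]] := torsion_part_Fac X.
have [_ _ p1] := ip; exists Xt, Xf, i, p; split=> //; split; first exact: UXf.
exact: star_quot_Fac fg UX1 MX2 p1 UXf.
Qed.

Lemma eq_star S S' : S `=` S' -> star (Fac U) S `=` star (Fac U) S'.
Proof.
by move=> SS' X; split=> -[X1 [X2 [f [g [UX1 SX2 fg]]]]]; exists X1, X2, f, g;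
  split=> //; apply/SS'.
Qed.

Lemma eq_left_approx S S' X : S `=` S' -> has_left_approx S X -> has_left_approx S' X.
Proof.
move=> SS' [N [f [SN fE]]]; exists N, f; split; first exact/SS'.
by move=> N' g S'N'; apply: fE; apply/SS'.
Qed.

Section Compatible.
Hypothesis Mtop : Fac M `<=` rtop.

Lemma star_wide_rperp : T `=` star (Fac U) (rperp U `&` Fac M).
Proof. by move=> X; apply: iff_sym; apply: eq_star; apply: rperp_Fac_wide. Qed.

Lemma wide_Fac_ff : functorially_finite W (W `&` Fac M).
Proof.
move=> X WX; split; last exact: torsion_class_right_approx wide_Fac_torsion WX.
exact: eq_left_approx (rperp_Fac_wide Mtop) (rperp_Fac_left_approx X).
Qed.

Lemma star_ftors : ftors U Q T.
Proof.
split; first exact: star_tors.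
move=> X _; split; last by case: star_tors => tc _ _; apply: torsion_class_right_approx tc _.
have TE : star (Fac U) (Fac M) `=` T.
  by move=> Y; rewrite (star_wide_rperp Y) (star_rperp_Fac Y).
apply: eq_left_approx TE _.
by apply: star_left_approx => Y; apply: Fac_left_approx.
Qed.
End Compatible.
End Reduction.

(** * Krull-Schmidt and dimensions of Hom spaces *)

Section KrullSchmidt.
Variables (K : fieldType) (A : falgType K).
Implicit Types (L M N X Y Z E C P : rmod A) (T : subcat A).

Notation mdim M := (\dim {: rmod_car M}).
Notation reg := (rmod_regular A).

(** By Fitting's lemma the stable image of [f] is zero or everything. If it is zero, [f] is
    nilpotent, while [g x = 0] makes [x] a fixed point of [f]. *)
Lemma indec_local_id X (f g : rhom X X) : indecomposable X ->
  (forall x, f x + g x = x) -> rmono f \/ rmono g.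
Proof.
move=> [_ Xind] fg; have [k [Y [q [j [q1 j0 jE qj0]]]]] := fitting f.
have [Z XYZ] := retract_dsummand qj0; case: (Xind Y Z XYZ) => [Y0|Z0].
  right; apply/rmonoP => x gx; have fx : f x = x by rewrite -[RHS]fg gx addr0.
  have <- : iter k.+1 f x = x by elim: k.+1 => // n IHn; rewrite iterS IHn fx.
  by rewrite -jE (Y0 (q x)) linear0.
have q0 : rmono q.
  apply: repi_mono_dim => //.
  by rewrite (riso_dim XYZ) dsum_dim ((rzeroP Z).1 Z0) addn0.
left; apply/rmonoP => x fx; apply: (rmono_inj q0); apply: (rmono_inj j0).
by rewrite jE iterSr fx !linear0; elim: k {jE} => // n IHn; rewrite iterS IHn linear0.
Qed.

Lemma indec_local X (f g : rhom X X) : indecomposable X ->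
  rmono (f + g) -> rmono f \/ rmono g.
Proof.
move=> Xind fg0; have [h [hL hR]] := rhom_inv fg0 (rmono_epi_dim fg0 (leqnn _)).
have mono_l (u : rhom X X) : rmono (rhom_comp h u) -> rmono u.
  move=> /rmonoP hu; apply/rmonoP => x ux; apply: hu.
  by rewrite rhom_compE ux linear0.
have [x||] := @indec_local_id X (rhom_comp h f) (rhom_comp h g) Xind.
- by rewrite -[RHS]hL rhomDE linearD !rhom_compE.
- by move/mono_l; left.
- by move/mono_l; right.
Qed.

Lemma indec_dsummand X M : indecomposable M -> ~ rzero X -> dsummand X M -> riso X M.
Proof.
move=> [_ Mind] X0 [Y XY]; case: (Mind _ _ XY) => // Y0.
exact: riso_trans (dsum0r X Y0) (riso_sym XY).
Qed.

Lemma indec_dsummand_dsums X (I : eqType) (F : I -> rmod A) (s : seq I) :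
    indecomposable X -> dsummand X (dsums [seq F i | i <- s]) ->
  exists2 i, i \in s & dsummand X (F i).
Proof.
move=> Xind /dsummandP[a [b ba]].
(* Weakened from the identity to an injective composite, so that the induction can pass to one
   summand of [b]. *)
have : rmono (rhom_comp b a) by apply/rmonoP => x; rewrite rhom_compE ba.
move=> {ba}; elim: s a b => [|i s IHs].
  move=> a b /rmonoP ba; case: Xind => -[] x.
  by apply: ba; rewrite rhom_compE (rmod0_zero (a x)) linear0.
rewrite map_cons dsums_cons; move: (dsums _) IHs => Z IHs a b ba.
have [f [g [p [q bE]]]] := dsum_hom_ex b.
have : rmono (rhom_comp f (rhom_comp p a) + rhom_comp g (rhom_comp q a)).
  by apply/rmonoP => x; rewrite rhomDE !rhom_compE => e; apply: ((rmonoP _).1 ba);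
    rewrite rhom_compE bE rhomDE !rhom_compE.
case/(indec_local Xind) => [/retract_dsummand|/IHs[k ks]]; first by exists i; rewrite ?mem_head.
by exists k => //; rewrite inE ks orbT.
Qed.

Lemma dsummand_dsums (I : eqType) (F : I -> rmod A) (s : seq I) i : i \in s ->
  dsummand (F i) (dsums [seq F i | i <- s]).
Proof.
elim: s => // j s IHs; rewrite inE => /orP[/eqP->|/IHs is_]; first exact: dsummand_dsuml.
exact: dsummand_trans is_ (dsummand_dsumr _ _).
Qed.

Lemma indec_decomposition M : exists q (F : 'I_q -> rmod A),
  (forall i, indecomposable (F i)) /\ riso M (dsums [seq F i | i <- enum 'I_q]).
Proof.
suff [s [sind sE]] : exists s : seq (rmod A),
    (forall i, (i < size s)%N -> indecomposable (nth (rmod0 A) s i)) /\ riso M (dsums s).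
  exists (size s), (fun i => nth (rmod0 A) s i); split; first by move=> i; exact: (sind _ (ltn_ord i)).
  have -> : [seq nth (rmod0 A) s (i : 'I_(size s)) | i <- enum 'I_(size s)] = s.
    rewrite -[RHS](mkseq_nth (rmod0 A)) /mkseq -val_enum_ord -map_comp.
    exact: eq_map.
  exact: sE.
have [n] := ubnP (mdim M); elim: n M => // n IHn M Mn.
have [M0|M0] := pselect (rzero M).
  by exists [::]; split=> //; apply: rzero_riso.
have [Mind|Mdec] := pselect (indecomposable M).
  exists [:: M]; split; first by case.
  exact: dsum0r (@rmod0_zero K A).
have [X [Y [XY X0 Y0]]] : exists X Y, [/\ riso M (dsum X Y), ~ rzero X & ~ rzero Y].
  apply: contrapT => H; apply: Mdec; split=> // X Y XY; apply: contrapT => /not_orP[X0 Y0].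
  by apply: H; exists X, Y.
have /eqP := riso_dim XY; rewrite dsum_dim => dXY.
have dX : (0 < mdim X)%N by rewrite lt0n; apply/eqP => /rzeroP.
have dY : (0 < mdim Y)%N by rewrite lt0n; apply/eqP => /rzeroP.
rewrite ltnS in Mn; rewrite (eqP dXY) in Mn.
have [|s [sind sE]] := IHn X.
  by apply: leq_trans Mn; rewrite -[X in (X < _)%N]addn0 ltn_add2l.
have [|t [tind tE]] := IHn Y.
  by apply: leq_trans Mn; rewrite -[X in (X < _)%N]add0n ltn_add2r.
exists (s ++ t); split.
  move=> i; rewrite size_cat nth_cat; case: (ltnP i (size s)) => [lt _|ge lt]; first exact: sind.
  by apply: tind; rewrite ltn_subLR.
apply: riso_trans XY _; apply: riso_trans (dsum_riso sE tE) _.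
exact/riso_sym/dsums_cat.
Qed.

(** * Dimensions of Hom spaces *)

Definition hdim X Y := \dim {: rhom X Y}.

Lemma lin_exact_dim (V1 V2 V3 : vectType K) (f : 'Hom(V1, V2)) (g : 'Hom(V2, V3)) :
  lker f = 0%VS -> limg f = lker g -> \dim {: V2} = (\dim {: V1} + \dim (limg g))%N.
Proof.
move=> f0 fg; rewrite -(limg_ker_dim g fullv) capfv -fg; congr addn.
by apply: limg_dim_eq; rewrite f0 capv0.
Qed.

(** Applied to presentations, where [f] may have a kernel: the last hypothesis says that [Hom(f, Y)]
    is onto. *)
Lemma hdim_contra L M N Y (f : rhom L M) (g : rhom M N) :
    repi g -> (forall y, g y = 0 <-> exists x, f x = y) ->
    (forall h : rhom L Y, exists k : rhom M Y, forall x, h x = k (f x)) ->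
  hdim M Y = (hdim N Y + hdim L Y)%N.
Proof.
move=> g1 fgE fs; rewrite /hdim (@lin_exact_dim _ _ _ (precomp Y g) (precomp Y f)).
- congr addn; suff -> : limg (precomp Y f) = fullv by [].
  apply/vspaceP => h; rewrite memvf; have [k kE] := fs h; apply/memv_imgP; exists k.
    exact: memvf.
  by rewrite precompE; apply: rhomP => x; rewrite rhom_compE kE.
- apply/vspaceP => h; rewrite memv_ker memv0 precompE; apply/eqP/eqP => [hg|->].
    apply: rhomP => y; have [x <-] := (repiP g).1 g1 y.
    by rewrite -rhom_compE hg !rhomD0.
  by apply: rhomP => x; rewrite rhom_compE !rhomD0.
apply/vspaceP => h; rewrite memv_ker precompE; apply/idP/eqP.
  move=> /memv_imgP[k _ ->]; rewrite precompE; apply: rhomP => x.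
  by rewrite !rhom_compE (fgE (f x)).2 ?linear0 ?rhomD0 //; exists x.
move=> hf; have [|k kE] := epi_factor (f := h) g1.
  by move=> _ /fgE[x <-]; rewrite -rhom_compE hf rhomD0.
apply/memv_imgP; exists k; first exact: memvf.
by rewrite precompE; apply: rhomP => x; rewrite rhom_compE kE.
Qed.

Lemma hdim_left_exact N X Y Z (i : rhom X Y) (e : rhom Y Z) :
    rmono i -> limg i = lker e ->
  hdim N Y = (hdim N X + \dim (limg (postcomp N e)))%N.
Proof.
move=> i0 /exactP ieE; apply: (@lin_exact_dim _ _ _ (postcomp N i)).
  apply/vspaceP => h; rewrite memv_ker memv0 postcompE; apply/eqP/eqP => [hi|->].
    apply: rhomP => x; apply: (rmono_inj i0).
    by rewrite -rhom_compE hi !rhomD0 linear0.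
  by apply: rhomP => x; rewrite rhom_compE !rhomD0 linear0.
apply/vspaceP => h; rewrite memv_ker postcompE; apply/idP/eqP.
  move=> /memv_imgP[k _ ->]; rewrite postcompE; apply: rhomP => x.
  by rewrite !rhom_compE rhomD0; apply/ieE; exists ((k : rhom N X) x).
move=> eh; have [|k kE] := mono_factor (f := h) i0.
  by move=> x; apply/ieE; rewrite -rhom_compE eh rhomD0.
apply/memv_imgP; exists k; first exact: memvf.
by rewrite postcompE; apply: rhomP => x; rewrite rhom_compE kE.
Qed.

Lemma hdim_eq0 X Y : hdim X Y = 0%N <-> hom0 X Y.
Proof.
split=> [/eqP|X0].
  rewrite dimv_eq0 => /eqP V0 f; apply/eqP.
  by rewrite -memv0 -V0 memvf.
apply/eqP; rewrite dimv_eq0; apply/eqP/vspaceP => f.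
by rewrite memvf memv0 (X0 f) eqxx.
Qed.

Lemma hdim_postcomp_surj N X Y Z (i : rhom X Y) (e : rhom Y Z) :
    rmono i -> limg i = lker e ->
    (forall g : rhom N Z, exists h : rhom N Y, forall x, e (h x) = g x) ->
  hdim N Y = (hdim N X + hdim N Z)%N.
Proof.
move=> i0 ie es; rewrite (hdim_left_exact N i0 ie); congr addn.
suff -> : limg (postcomp N e) = fullv by [].
apply/vspaceP => g; rewrite memvf; have [h hE] := es g; apply/memv_imgP; exists h.
  exact: memvf.
by rewrite postcompE; apply: rhomP => x; rewrite rhom_compE hE.
Qed.

Lemma hdim_dsum M N Y : hdim (dsum M N) Y = (hdim N Y + hdim M Y)%N.
Proof.
have [i iE] := inl_ex M N; have [q qE] := snd_ex M N; have [p pE] := fst_ex M N.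
apply: (@hdim_contra _ _ _ _ i q).
- by apply/repiP => y; exists (0, y); rewrite qE.
- move=> [x y]; rewrite qE /=; split=> [->|[z]]; first by exists x; rewrite iE.
  by rewrite iE => -[].
- by move=> h; exists (rhom_comp h p) => x; rewrite rhom_compE pE iE.
Qed.

Lemma hdim_rzero M Y : rzero M -> hdim M Y = 0%N.
Proof. by move=> M0; apply/hdim_eq0/hom0P => f x; rewrite (M0 x) linear0. Qed.

Lemma hdim_riso M N Y : riso M N -> hdim M Y = hdim N Y.
Proof.
move=> [f [f0 f1]]; rewrite (@hdim_contra (rmod0 A) M N Y 0 f) //.
- by rewrite (hdim_rzero Y (@rmod0_zero K A)) addn0.
- move=> y; split=> [/((rmonoP f).1 f0)->|[x <-]]; last by rewrite rhomD0 linear0.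
  by exists 0; rewrite linear0.
- by move=> h; exists 0 => x; rewrite (rmod0_zero x) !linear0.
Qed.

Lemma hdim_dsums I (F : I -> rmod A) (s : seq I) Y :
  hdim (dsums [seq F i | i <- s]) Y = (\sum_(i <- s) hdim (F i) Y)%N.
Proof.
elim: s => [|i s IHs]; first by rewrite big_nil hdim_rzero //; apply: rmod0_zero.
by rewrite map_cons dsums_cons big_cons hdim_dsum IHs addnC.
Qed.

Lemma hdim_comb m (F : 'I_m -> rmod A) M :
    (forall X, indecomposable X -> dsummand X M -> exists i, riso X (F i)) ->
  exists a : 'I_m -> nat, forall Y, hdim M Y = (\sum_i a i * hdim (F i) Y)%N.
Proof.
move=> MF; have [q [G [Gind MG]]] := indec_decomposition M.
have GM t : dsummand (G t) M.
  apply: dsummand_trans (riso_dsummand (riso_sym MG)).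
  by apply: dsummand_dsums; rewrite mem_enum.
have [c cE] := choice (fun t => MF (G t) (Gind t) (GM t)).
(* The multiplicity of [F i]: the number of summands [G t] that the choice [c] assigns to it. *)
exists (fun i => \sum_(t < q | c t == i) 1)%N => Y.
rewrite (hdim_riso Y MG) hdim_dsums big_enum /=.
rewrite (partition_big c xpredT) //=; apply: eq_bigr => i _.
rewrite big_distrl /=; apply: eq_bigr => t /eqP ct.
by rewrite mul1n -ct; apply: hdim_riso.
Qed.

Lemma riso_representatives q (F : 'I_q -> rmod A) : exists m (r : 'I_m -> 'I_q),
  (forall i j, riso (F (r i)) (F (r j)) -> i = j) /\ (forall t, exists i, riso (F t) (F (r i))).
Proof.
(* The indices without an isomorphic predecessor. *)
pose B := [set t : 'I_q | [forall u : 'I_q, (u < t)%N ==> ~~ `[< riso (F u) (F t) >]]].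
have Bmin t : exists2 b, b \in B & riso (F t) (F b).
  have [n] := ubnP (t : nat); elim: n t => // n IHn t tn.
  have [tB|] := boolP (t \in B); first by exists t => //; apply: riso_refl.
  rewrite inE negb_forall => /existsP[u]; rewrite negb_imply negbK => /andP[ut /asboolP utE].
  have [|b bB ub] := IHn u; first exact: leq_trans ut tn.
  by exists b => //; apply: riso_trans (riso_sym utE) ub.
have Bneq i j : i \in B -> j \in B -> riso (F i) (F j) -> i = j.
  move=> iB jB ij; apply/val_inj => /=; case: (ltngtP i j) => // lt.
    by move: jB; rewrite inE => /forallP/(_ i); rewrite lt /= => /asboolP[].
  move: iB; rewrite inE => /forallP/(_ j); rewrite lt /= => /asboolP[].
  exact: riso_sym.
exists #|B|, (fun i => enum_val i); split.
  by move=> i j ij; apply: enum_val_inj; apply: Bneq ij; apply: enum_valP.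
move=> t; have [b bB tb] := Bmin t; exists (enum_rank_in bB b).
by rewrite enum_rankK_in.
Qed.

Lemma num_summands_dsums M m (F : 'I_m -> rmod A) :
    (forall i, indecomposable (F i)) -> (forall i j, riso (F i) (F j) -> i = j) ->
    riso M (dsums [seq F i | i <- enum 'I_m]) ->
  num_summands M m.
Proof.
move=> Find Finj MF; exists F; split=> // [i|Y Yind YM].
  split=> //; apply: dsummand_trans (riso_dsummand (riso_sym MF)).
  by apply: dsummand_dsums; rewrite mem_enum.
have [i _ Yi] := indec_dsummand_dsums Yind (dsummand_trans YM (riso_dsummand MF)).
by exists i; apply: indec_dsummand => //; case: Yind.
Qed.

Lemma diag_mulmx_leq (F : fieldType) m s (B : 'M[F]_(m, s)) (C : 'M[F]_(s, m)) :
    (forall i j, i != j -> (B *m C) i j = 0) -> (forall i, (B *m C) i i != 0) ->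
  (m <= s)%N.
Proof.
move=> off dia; have u : B *m C \in unitmx.
  have -> : B *m C = diag_mx (\row_i (B *m C) i i).
    apply/matrixP => i j; rewrite [RHS]mxE [X in X *+ _]mxE.
    by case: eqVneq => [->|/off->]; rewrite ?mulr1n ?mulr0n.
  rewrite unitmxE det_diag unitfE; apply/prodf_neq0 => i _.
  by rewrite mxE; apply: dia.
by rewrite -(mxrank_unit u); apply: leq_trans (mxrankM_maxl _ _) (rank_leq_col _).
Qed.

(* [Y1 + Y2 - Y3] plays the role of a virtual module dual to [F j]. *)
Lemma hdim_count T m s (F : 'I_m -> rmod A) (G : 'I_s -> rmod A) (a b : 'I_m -> 'I_s -> nat) :
    (forall i Y, T Y ->
      (hdim (F i) Y + \sum_k b i k * hdim (G k) Y = \sum_k a i k * hdim (G k) Y)%N) ->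
    (forall j, exists Y1 Y2 Y3 d, [/\ T Y1, T Y2, T Y3, (0 < d)%N &
      forall i, (hdim (F i) Y1 + hdim (F i) Y2 = hdim (F i) Y3 + (i == j) * d)%N]) ->
  (m <= s)%N.
Proof.
move=> FG /choice[Y1] /choice[Y2] /choice[Y3] /choice[d test].
pose B : 'M[rat]_(m, s) := \matrix_(i, k) ((a i k)%:R - (b i k)%:R).
pose h k j : rat := (hdim (G k) (Y1 j))%:R + (hdim (G k) (Y2 j))%:R - (hdim (G k) (Y3 j))%:R.
have FE i Y : T Y -> (hdim (F i) Y)%:R = \sum_k B i k * (hdim (G k) Y)%:R :> rat.
  move=> TY; have := congr1 (fun n => n%:R : rat) (FG i Y TY).
  rewrite /= natrD => /(canRL (addrK _)) ->; rewrite !natr_sum -sumrB.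
  by apply: eq_bigr => k _; rewrite mxE mulrBl !natrM.
(* Row [i] of [B] expresses [F i] through the [G k], and column [j] of [h] evaluates these at the
   virtual module. The product is thus [F i] evaluated there. *)
have E i j : (B *m \matrix_(k, j) h k j) i j = ((i == j) * d j)%:R.
  have [T1 T2 T3 _ tE] := test j; rewrite mxE.
  have := congr1 (fun n => n%:R : rat) (tE i); rewrite /= !natrD !FE // => /(canLR (addKr _)) <-.
  rewrite addrC -big_split -sumrB /=.
  by apply: eq_bigr => k _; rewrite mxE /h mulrBr mulrDr.
apply: (@diag_mulmx_leq _ _ _ B (\matrix_(k, j) h k j)) => [i j ij|i]; rewrite E; first by rewrite (negPf ij).
by have [_ _ _ d0 _] := test i; rewrite eqxx mul1n Num.Theory.pnatr_eq0 -lt0n.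
Qed.

End KrullSchmidt.

(** * The tau-tilting pair of a torsion class *)

Section SupportTauTilting.
Variables (K : fieldType) (A : falgType K) (T : subcat A).
Hypotheses (Tq : quot_closed T) (Te : ext_closed T) (T0 : T (rmod0 A)).
Hypothesis Ta : forall X, has_left_approx T X.
Implicit Types (L M N X Y Z E C P : rmod A).

Notation mdim M := (\dim {: rmod_car M}).
Notation reg := (rmod_regular A).

Lemma pullback_ex X E C M (f : rhom X E) (e : rhom E C) (g : rhom M C) : short_exact f e ->
  exists E' (f' : rhom X E') (e' : rhom E' M) (h : rhom E' E),
    short_exact f' e' /\ forall x, e (h x) = g (e' x).
Proof.
move=> /short_exactP[f0 e1 feE]; have [u uE] := copair_ex e (- g).
have [E' [k [k0 kE]]] := ker_ex u.
have [p pE] := fst_ex E M; have [q qE] := snd_ex E M; have [i iE] := inl_ex E M.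
have kP x : (exists y, k y = x) <-> e x.1 = g x.2.
  rewrite -rimP kE memv_ker uE rhomNE subr_eq0.
  by split=> /eqP.
have [f' f'E] : exists f' : rhom X E', forall x, k (f' x) = rhom_comp i f x.
  apply: mono_factor => // x; apply/kP; rewrite rhom_compE iE /= linear0.
  by apply/feE; exists x.
have hE x : e (rhom_comp p k x) = g (rhom_comp q k x).
  by rewrite !rhom_compE pE qE; apply/kP; exists x.
exists E', f', (rhom_comp q k), (rhom_comp p k); split=> //.
apply/short_exactP; split.
- apply/rmonoP => x f'x; apply: ((rmonoP f).1 f0).
  by have := f'E x; rewrite f'x linear0 rhom_compE iE => -[].
- apply/repiP => m; have [y ey] := (repiP e).1 e1 (g m).
  have [z zE] := (kP (y, m)).2 ey.
  by exists z; rewrite rhom_compE zE qE.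
- move=> y; split=> [qy|[x <-]]; last by rewrite rhom_compE f'E rhom_compE iE qE.
  have /feE[x xy] : e (rhom_comp p k y) = 0 by rewrite hE qy linear0.
  exists x; apply: (rmono_inj k0); rewrite f'E rhom_compE iE xy.
  move: qy; rewrite !rhom_compE pE qE; case: (k y) => a b /= -> //.
Qed.

Lemma proj_min_left_approx P : rprojective P ->
  exists T0 T1 (f : rhom P T0) (g : rhom T0 T1),
    [/\ repi g, forall y, g y = 0 <-> exists x, f x = y, T T0 /\ T T1,
        forall Y (h : rhom P Y), T Y -> exists k : rhom T0 Y, forall x, h x = k (f x) &
        ext_projective T T0 /\ ext_projective T T1].
Proof.
move=> Pp; pose approx N (f : rhom P N) := T N /\
  forall Y (h : rhom P Y), T Y -> exists k : rhom N Y, forall x, h x = k (f x).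
have [|[N f] /= [TN fE] fmin] := @ex_mindim {N & rhom P N}
    (fun t => approx (tag t) (tagged t)) (fun t => mdim (tag t)).
  have /has_left_approxP[N [f [TN fE]]] := Ta P.
  exists (Tagged (fun N => rhom P N) f); split=> // Y h /(fE _ h)[k kE].
  by exists k => x; rewrite /= kE.
(* The image of [c] is a quotient of [N], hence in [T], and still approximates [P], so it cannot be
   smaller than [N]. *)
have f_left_min (c : rhom N N) : (forall x, c (f x) = f x) -> rmono c.
  move=> cf; have [I [q [j [q1 j0 jE]]]] := im_ex c.
  suff dI : (mdim N <= mdim I)%N.
    have q0 := repi_mono_dim q1 dI; apply/rmonoP => x cx.
    by apply: (rmono_inj q0); apply: (rmono_inj j0); rewrite jE cx !linear0.
  apply: (fmin (Tagged (fun N => rhom P N) (rhom_comp q f))).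
  split=> [|Y h TY]; first exact: Tq q1 TN.
  have [k kE] := fE Y h TY; exists (rhom_comp k j) => x.
  by rewrite !rhom_compE jE cf kE.
have Np : ext_projective T N.
  move=> X E C f' e fe TX g.
  (* The pullback [E'] is an extension of [N] by [X], hence in [T]. A lift of [f] to [E'] extends to
     [m] on [N]; since [e' m] fixes [f] it is invertible, which splits the pullback. *)
  have [E' [f'' [e' [h [fe' hE]]]]] := pullback_ex g fe.
  have [_ _ e'1] := fe'.
  have [l lE] := proj_lift f Pp e'1.
  have [m mE] := fE E' l (Te fe' TX TN).
  have c0 : rmono (rhom_comp e' m).
    by apply: f_left_min => x; rewrite rhom_compE -mE lE.
  have [d [_ dR]] := rhom_inv c0 (rmono_epi_dim c0 (leqnn _)).
  exists (rhom_comp h (rhom_comp m d)) => x.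
  by rewrite !rhom_compE hE -(rhom_compE e' m) dR.
have [N1 [g [g1 /exactP gE]]] := coker_ex f.
exists N, N1, f, g; split=> //; split=> //; first exact: Tq g1 TN.
(* For the cokernel, lift over [N] first. On [P] the lift lands in [X], which is in [T], so this
   part extends over [N] and is subtracted. *)
move=> X E C f' e fe TX a; have /short_exactP[f'0 e1 feE] := fe.
have [l lE] := Np _ _ _ _ _ fe TX (rhom_comp a g).
have [u uE] : exists u : rhom P X, forall x, f' (u x) = rhom_comp l f x.
  apply: mono_factor => // x; apply/feE; rewrite rhom_compE lE rhom_compE.
  by rewrite (gE (f x)).2 ?linear0 //; exists x.
have [v vE] := fE X u TX.
have [|h hE] := epi_factor (f := l - rhom_comp f' v) g1.
  by move=> _ /gE[x <-]; rewrite rhomBE rhom_compE -vE uE rhom_compE subrr.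
exists h => x; have [y <-] := (repiP g).1 g1 x.
rewrite hE rhomBE linearB /= lE !rhom_compE.
by rewrite (feE (f' (v y))).2 ?subr0 //; exists (v y).
Qed.

(** Each [y], seen as a map from [A], lies in the image of a map from [N]. So a module in [Fac N]
    with image in [Y] of maximal dimension covers [Y]. *)
Lemma Fac_of_reg_approx N Y :
  (forall g : rhom reg Y, exists (f : rhom reg N) (h : rhom N Y), forall x, g x = h (f x)) ->
  Fac N Y.
Proof.
move=> H.
have [|t _|[Z e] /= NZ emax] := @ex_maxdim {Z & rhom Z Y} (fun t => Fac N (tag t))
    (fun t => \dim (limg (tagged t))) (mdim Y).
- exists (Tagged (fun Z => rhom Z Y) (0 : rhom (rmod0 A) Y)); exact: Fac0.
- by rewrite dimvS ?subvf.
suff e1 : repi e by exact: Fac_quot e1 NZ.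
apply/repiP => y; apply: contrapT => yN.
have [f [h hE]] := H (reg_map y).
have [e' e'E] := copair_ex e h.
have e'im : (limg e <= limg e')%VS.
  apply/subvP => _ /rimP[x <-]; apply/rimP; exists (x, 0).
  by rewrite e'E /= linear0 addr0.
have le : (\dim (limg e') <= \dim (limg e))%N.
  exact: (emax (Tagged (fun Z => rhom Z Y) e') (Fac_dsum NZ (Fac_self N))).
have /eqP imE : limg e == limg e' by rewrite eqEdim e'im.
apply: yN; apply/rimP; rewrite imE; apply/rimP; exists (0, f (1 : A)).
by rewrite e'E /= linear0 add0r -hE reg_mapE ract1x.
Qed.

(** * Counting indecomposable summands *)

Section Count.
Variables (n : nat) (P : 'I_n -> rmod A).
Hypotheses (Pind : forall k, indecomposable (P k)).
Hypotheses (Pinj : forall k l, riso (P k) (P l) -> k = l).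
Hypotheses (PA : riso reg (dsums [seq P k | k <- enum 'I_n])).

Lemma indec_proj_dsummand k : dsummand (P k) reg.
Proof.
apply: dsummand_trans (riso_dsummand (riso_sym PA)).
by apply: dsummand_dsums; rewrite mem_enum.
Qed.

Lemma indec_proj k : rprojective (P k).
Proof. exact: rprojective_dsummand (indec_proj_dsummand k) (@rprojective_reg K A). Qed.

Lemma indec_proj_class X : indecomposable X -> rprojective X -> exists k, riso X (P k).
Proof.
move=> Xind /proj_dsummand_free[r]; rewrite nseq_map => /(indec_dsummand_dsums Xind)[_ _ XA].
have [k _ Xk] := indec_dsummand_dsums Xind (dsummand_trans XA (riso_dsummand PA)).
by exists k; apply: indec_dsummand => //; case: Xind.
Qed.

(** The indices outside this set give the projective half of the pair. *)
Definition supported := [set k : 'I_n | `[< exists2 Y, T Y & ~ hom0 (P k) Y >]].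

Lemma unsupported_hom0 k Y : k \notin supported -> T Y -> hom0 (P k) Y.
Proof.
rewrite inE => /asboolP kS TY; apply: contrapT => H; apply: kS; by exists Y.
Qed.

(* For a nonzero map from [P l] to a module [Y] in [T] with [dim Y] minimal, the
   image [L] is simple and [Z = Y / L] is in [T], so [Y - Z] tests like [L]. *)
Lemma supported_test l : l \in supported -> exists Y Z d, [/\ T Y, T Z, (0 < d)%N &
  forall k, hdim (P k) Y = (hdim (P k) Z + (k == l) * d)%N].
Proof.
rewrite inE => /asboolP[Y0 TY0 /hom0P Y0n].
have [|[Y u] /= [TY un] umin] := @ex_mindim {Y & rhom (P l) Y}
    (fun t => T (tag t) /\ exists x, tagged t x <> 0) (fun t => mdim (tag t)).
  apply: contrapT => H; apply: Y0n => f x; apply: contrapT => fx; apply: H.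
  by exists (Tagged (fun Y => rhom (P l) Y) f); split=> //; exists x.
have [I [a [j [a1 j0 jE]]]] := im_ex u.
have [Z [c [c1 cE]]] := coker_ex j.
have a_n : a <> 0.
  by move=> a0; case: un => x; rewrite -jE a0 rhomD0 linear0.
exists Y, Z, (hdim (P l) I); split=> //; first exact: Tq c1 TY.
  by rewrite lt0n; apply/eqP => /hdim_eq0/(_ a).
move=> k; rewrite (hdim_postcomp_surj j0 cE); last first.
  by move=> g; exact: (proj_lift g (@indec_proj k) c1).
rewrite addnC; congr addn; case: eqVneq => [->|kl]; first by rewrite mul1n.
rewrite mul0n; apply/hdim_eq0/hom0P => v x; apply: contrapT => vx.
(* In the quotient of [Y] by the image of [v], which is smaller and in [T], the map [u] must become
   zero. So the image of [v] is all of [I]. *)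
have v1 : repi v.
  have [V [q [i [q1 i0 iE]]]] := im_ex v.
  have [D [d [d1 dE]]] := coker_ex (rhom_comp j i).
  have du y : d (u y) = 0.
    apply: contrapT => duy.
    have ex : short_exact (rhom_comp j i) d by split=> //; apply: rmono_comp.
    have lt : (mdim D < mdim Y)%N.
      rewrite (short_exact_dim ex) -[X in (X < _)%N]add0n ltn_add2r lt0n.
      by apply/eqP => /rzeroP V0; apply: vx; rewrite -iE (V0 (q x)) linear0.
    have := umin (Tagged (fun Y => rhom (P l) Y) (rhom_comp d u)).
    rewrite leqNgt lt => /(_ _)/notF[]; split; first exact: Tq d1 TY.
    by exists y; rewrite rhom_compE.
  have /exactP dE' := dE.
  apply/repiP => z; have [y <-] := (repiP a).1 a1 z.
  have /dE'[w wE] := du y; have [t tw] := (repiP q).1 q1 w.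
  by exists t; apply: (rmono_inj j0); rewrite -iE tw jE -wE rhom_compE.
(* Lifting between the two covers of [I] gives an endomorphism [h' h] of [P l] over [I]. By locality
   it or its difference from the identity is injective: the first makes [P l] isomorphic to [P k],
   the second makes [a] zero. *)
have [h hE] := proj_lift a (@indec_proj l) v1.
have [h' h'E] := proj_lift v (@indec_proj k) a1.
have [||] := @indec_local _ _ _ (rhom_comp h' h) (rid (P l) - rhom_comp h' h) (Pind l).
- by apply/rmonoP => y; rewrite addrC subrK ridE.
- move=> /retract_dsummand/indec_dsummand ds; case/eqP: kl; apply/esym/Pinj/ds => //.
  by have [] := Pind l.
- move=> g0; case: a_n; apply: rhomP => y.
  have [z <-] := (repiP _).1 (rmono_epi_dim g0 (leqnn _)) y.
  by rewrite rhomBE linearB /= ridE rhom_compE h'E hE subrr rhomD0.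
Qed.

Lemma hdim_supported (a : 'I_n -> nat) Y : T Y ->
  (\sum_k a k * hdim (P k) Y =
   \sum_(i < #|supported|) a (enum_val i) * hdim (P (enum_val i)) Y)%N.
Proof.
move=> TY; rewrite (bigID (mem supported)) /= [X in (_ + X)%N]big1 ?addn0.
  by rewrite big_enum_val.
by move=> k kS; rewrite (hdim_eq0 _ _).2 ?muln0 //; apply: unsupported_hom0.
Qed.

Section Rank.
Variables (m : nat) (N : 'I_m -> rmod A).
Hypotheses (Nind : forall i, indecomposable (N i)).
Hypotheses (Ninj : forall i j, riso (N i) (N j) -> i = j).
Hypotheses (TN : forall i, T (N i)) (Np : forall i, ext_projective T (N i)).

(* With [X = N j], take [e : E -> X] in [T] not split epi and of maximal image on
   [Hom(NN, -)]: every other map [N i -> X] which is not split epi factors through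
   it, so the test module is [X - E] plus the torsion part of [ker e]. *)
Lemma ext_projective_test j : exists Y1 Y2 Y3 d, [/\ T Y1, T Y2, T Y3, (0 < d)%N &
  forall i, (hdim (N i) Y1 + hdim (N i) Y2 = hdim (N i) Y3 + (i == j) * d)%N].
Proof.
(* The sum [NN] lets a single map [e] serve all [N i] at once. *)
pose X := N j; pose NN := dsums [seq N i | i <- enum 'I_m].
have X0 : ~ rzero X by case: (Nind j).
(* Not split epi: a section exists as soon as some composite is injective, since that composite is
   then invertible. In this form locality of [End X] passes it to sums. *)
pose nonsplit Z (e : rhom Z X) := forall s : rhom X Z, ~ rmono (rhom_comp e s).
have nonsplitD Z Z' (e : rhom Z X) (e' : rhom Z' X) (c : rhom (dsum Z Z') X) :
    nonsplit Z e -> nonsplit Z' e' -> (forall x, c x = e x.1 + e' x.2) -> nonsplit _ c.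
  move=> en e'n cE s cs0.
  have [p pE] := fst_ex Z Z'; have [q qE] := snd_ex Z Z'.
  have E : rhom_comp c s = rhom_comp e (rhom_comp p s) + rhom_comp e' (rhom_comp q s).
    by apply: rhomP => x; rewrite rhomDE !rhom_compE cE pE qE.
  by move: cs0; rewrite E => /(indec_local (Nind j))[/en|/e'n].
have [|t _|[E e] /= [TE en] emax] := @ex_maxdim {Z & rhom Z X}
    (fun t => T (tag t) /\ nonsplit _ (tagged t))
    (fun t => \dim (limg (postcomp NN (tagged t)))) (hdim NN X).
- exists (Tagged (fun Z => rhom Z X) (0 : rhom (rmod0 A) X)); split=> //= s /rmonoP H.
  by apply: X0 => x; apply: H; rewrite rhom_compE rhomD0.
- by rewrite dimvS ?subvf.
have TNN : T NN by apply: ext_closed_dsums.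
have NNfac (g : rhom NN X) : nonsplit _ g -> exists h : rhom NN E, forall x, e (h x) = g x.
  move=> gn; have [c cE] := copair_ex e g.
  have [i iE] := inl_ex E NN; have [i' i'E] := inr_ex E NN.
  have sub : (limg (postcomp NN e) <= limg (postcomp NN c))%VS.
    apply/subvP => _ /memv_imgP[h _ ->]; apply/memv_imgP; exists (rhom_comp i h).
      exact: memvf.
    by rewrite !postcompE; apply: rhomP => x; rewrite !rhom_compE cE iE /= linear0 addr0.
  have le : (\dim (limg (postcomp NN c)) <= \dim (limg (postcomp NN e)))%N.
    apply: (emax (Tagged (fun Z => rhom Z X) c)); split=> /=.
      exact: ext_closed_dsum.
    exact: nonsplitD en gn cE.
  have /eqP imE : limg (postcomp NN e) == limg (postcomp NN c) by rewrite eqEdim sub.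
  have : g \in limg (postcomp NN e).
    rewrite imE; apply/memv_imgP; exists i'; first exact: memvf.
    by rewrite postcompE; apply: rhomP => x; rewrite rhom_compE cE i'E /= linear0 add0r.
  by move=> /memv_imgP[h _ ->]; exists h => x; rewrite postcompE rhom_compE.
have [L [l [l0 lE]]] := ker_ex e.
have [F [_ _ TF part]] := torsion_class_ext Tq Te T0.
(* The kernel of [e] may leave [T]. Its torsion part does not, and it receives the same maps from
   the [N k]. *)
have [Lt [Lf [i [p [TLt FLf ip]]]]] := part L I.
have [i0 ipE _] := ip.
(* The codimension in [End X] of the maps that factor through [e]; it is positive because the
   identity does not. *)
pose d := (hdim X X - \dim (limg (postcomp X e)))%N.
exists X, Lt, E, d; split=> //; first exact: TN.
  rewrite /d subn_gt0 ltn_neqAle dimvS ?subvf // andbT; apply/eqP => dE.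
  have /eqP imE : limg (postcomp X e) == fullv by rewrite eqEdim subvf dE leqnn.
  have : rid X \in limg (postcomp X e) by rewrite imE memvf.
  move=> /memv_imgP[h _]; rewrite postcompE => hE.
  by apply: (en h); rewrite -hE; apply/rmonoP => x; rewrite ridE.
move=> k; rewrite (hdim_left_exact (N k) l0 lE).
have -> : hdim (N k) L = hdim (N k) Lt.
  rewrite (hdim_left_exact (N k) i0 ipE) [X in (_ + X)%N](_ : _ = 0%N) ?addn0 //.
  apply/eqP; rewrite dimv_eq0 -subv0; apply/subvP => _ /memv_imgP[h _ ->].
  by rewrite memv0 (TF _ _ (TN k) FLf (postcomp (N k) p h)).
rewrite addnC -addnA; congr addn; case: eqVneq => [->|kj].
  by rewrite mul1n /d subnKC // dimvS ?subvf.
rewrite mul0n addn0; suff -> : limg (postcomp (N k) e) = fullv by [].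
apply/vspaceP => g; rewrite memvf.
have /dsummandP[s [r rs]] : dsummand (N k) NN by apply: dsummand_dsums; rewrite mem_enum.
have [|h hE] := NNfac (rhom_comp g r).
  move=> t tm; case/eqP: kj; apply/esym/Ninj/indec_dsummand => //.
  apply: (@retract_dsummand _ _ _ _ (rhom_comp r t) g).
  by apply/rmonoP => x; rewrite !rhom_compE => H; apply: ((rmonoP _).1 tm); rewrite !rhom_compE.
apply/memv_imgP; exists (rhom_comp h s); first exact: memvf.
by rewrite postcompE; apply: rhomP => x; rewrite !rhom_compE hE rhom_compE rs.
Qed.

(** No module in [T] maps to [tau (N i)], so [Hom(-, Y)] is exact on the minimal presentation of
    [N i]. The difference of the coefficients is the g-vector of [N i]. *)
Lemma ext_projective_rank_leq : (m <= #|supported|)%N.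
Proof.
have key i : exists ab : ('I_n -> nat) * ('I_n -> nat), forall Y, T Y ->
    (hdim (N i) Y + \sum_k ab.2 k * hdim (P k) Y = \sum_k ab.1 k * hdim (P k) Y)%N.
  have [P1 [P0 [p1 [p0 [[P1p P0p p0e /exactP pE _] tE]]]]] := tau_presentation (N i).
  have comb Z : rprojective Z -> exists a : 'I_n -> nat,
      forall Y, hdim Z Y = (\sum_k a k * hdim (P k) Y)%N.
    move=> Zp; apply: hdim_comb => X Xind XZ.
    by apply: indec_proj_class => //; apply: rprojective_dsummand XZ Zp.
  have [a aE] := comb P0 P0p; have [b bE] := comb P1 P1p.
  exists (a, b) => Y TY /=; rewrite -aE -bE -(hdim_contra p0e pE) //; apply/tE.
  exact: ext_projective_hom0_tau (@Np i) TY.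
have {key}[ab abE] := choice key.
apply: (@hdim_count _ _ T m _ N (fun i => P (enum_val i))
  (fun i k => (ab i).1 (enum_val k)) (fun i k => (ab i).2 (enum_val k))).
  by move=> i Y TY; rewrite -!hdim_supported // abE.
exact: ext_projective_test.
Qed.

Hypothesis Ngen : forall k, exists T0 T1 (f : rhom (P k) T0) (g : rhom T0 T1),
  [/\ repi g, forall y, g y = 0 <-> exists x, f x = y,
      forall Y (h : rhom (P k) Y), T Y -> exists k : rhom T0 Y, forall x, h x = k (f x) &
      forall X, indecomposable X -> dsummand X T0 \/ dsummand X T1 -> exists i, riso X (N i)].

Lemma ext_projective_rank_geq : (#|supported| <= m)%N.
Proof.
have key k : exists ab : ('I_m -> nat) * ('I_m -> nat), forall Y, T Y ->
    (hdim (P k) Y + \sum_i ab.2 i * hdim (N i) Y = \sum_i ab.1 i * hdim (N i) Y)%N.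
  have [Z0 [Z1 [f [g [g1 gE fE ZN]]]]] := Ngen k.
  have [a aE] := hdim_comb (fun X Xind XZ => ZN X Xind (or_introl XZ)).
  have [b bE] := hdim_comb (fun X Xind XZ => ZN X Xind (or_intror XZ)).
  exists (a, b) => Y TY /=; rewrite -aE -bE addnC -(hdim_contra g1 gE) // => h.
  exact: fE.
have {key}[ab abE] := choice key.
apply: (@hdim_count _ _ T _ m (fun i => P (enum_val i)) N
  (fun k i => (ab (enum_val k)).1 i) (fun k i => (ab (enum_val k)).2 i)).
  by move=> i Y TY; apply: abE.
move=> j; have [Y [Z [d [TY TZ d0 dE]]]] := supported_test (enum_valP j).
(* Two modules suffice for the projectives, and the zero module fills the remaining place. *)
exists Y, (rmod0 A), Z, d; split=> // i.
rewrite dE (inj_eq enum_val_inj) [hdim _ (rmod0 A)](_ : _ = 0%N) ?addn0 //.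
exact/hdim_eq0/hom00r.
Qed.
End Rank.
End Count.

Lemma support_tau_tilting_ex : basic reg ->
  exists N R, [/\ basic_pair N R, tau_tilting_pair N R & Fac N `=` T].
Proof.
move=> [n [P [Pind Pinj PA]]].
have [TA [TA1 [fA [_ [_ _ [TTA TTA1] fAE [TAp TA1p]]]]]] := proj_min_left_approx (@rprojective_reg K A).
have /choice[ZZ ZZP] k : exists ZZ : rmod A * rmod A, exists (f : rhom (P k) ZZ.1) (g : rhom ZZ.1 ZZ.2),
    [/\ repi g, forall y, g y = 0 <-> exists x, f x = y, T ZZ.1 /\ T ZZ.2,
        forall Y (h : rhom (P k) Y), T Y -> exists k : rhom ZZ.1 Y, forall x, h x = k (f x) &
        ext_projective T ZZ.1 /\ ext_projective T ZZ.2].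
  have [Z0 [Z1 H]] := proj_min_left_approx (@indec_proj _ _ PA k).
  by exists (Z0, Z1).
(* [TA] makes [B] generate [T], and the other summands supply every term needed in the rank
   count. *)
pose B := dsum TA (dsums [seq dsum (ZZ k).1 (ZZ k).2 | k <- enum 'I_n]).
have TB : T B.
  apply: ext_closed_dsum => //; apply: ext_closed_dsums => // k.
  by have [f [g [_ _ [? ?] _ _]]] := ZZP k; apply: ext_closed_dsum.
have Bp : ext_projective T B.
  apply: ext_projective_dsum => //; apply: ext_projective_dsums => k.
  by have [f [g [_ _ _ _ [? ?]]]] := ZZP k; apply: ext_projective_dsum.
have [q [F [Find BF]]] := indec_decomposition B.
have FB t : dsummand (F t) B.
  apply: dsummand_trans (riso_dsummand (riso_sym BF)).
  by apply: dsummand_dsums; rewrite mem_enum.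
(* One summand from each isomorphism class makes [N] basic. *)
have [m [r [rinj rsurj]]] := riso_representatives F.
pose Ni i := F (r i); pose N := dsums [seq Ni i | i <- enum 'I_m].
have Tsummand X Y : dsummand X Y -> T Y -> T X.
  move=> /dsummandP[s [r' rs]]; apply: Tq; apply/repiP => x.
  by exists (s x); apply: rs.
have TNi i : T (Ni i) by exact: (Tsummand _ _ (FB (r i)) TB).
have Nip i : ext_projective T (Ni i) by exact: (ext_projective_dsummand (FB (r i)) Bp).
have Nclass X : indecomposable X -> dsummand X B -> exists i, riso X (Ni i).
  move=> Xind XB.
  have [t _ Xt] := indec_dsummand_dsums Xind (dsummand_trans XB (riso_dsummand BF)).
  have [i ti] := rsurj t; exists i; apply: riso_trans ti.
  by apply: indec_dsummand => //; case: Xind.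
have TN : T N by apply: ext_closed_dsums.
have Np : ext_projective T N by apply: ext_projective_dsums.
have NB : Fac N B.
  apply: quot_closed_iso (@Fac_quot K A N) (riso_sym BF) _; apply: Fac_dsums => t.
  have [i /riso_sym ti] := rsurj t.
  apply: quot_closed_iso (@Fac_quot K A N) ti _.
  have /dsummandP[s [r' rs]] : dsummand (Ni i) N by apply: dsummand_dsums; rewrite mem_enum.
  apply: (@Fac_quot K A N _ _ r') (Fac_self N); apply/repiP => x.
  by exists (s x); apply: rs.
have FacN : Fac N `=` T.
  move=> Y; split; first exact: Fac_min.
  move=> TY; apply: Fac_trans (_ : Fac TA Y).
    have [u uE] := fst_ex TA (dsums [seq dsum (ZZ k).1 (ZZ k).2 | k <- enum 'I_n]).
    apply: (@Fac_quot K A N _ _ u) NB; apply/repiP => x.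
    by exists (x, 0); rewrite uE.
  apply: Fac_of_reg_approx => g; have [h hE] := fAE Y g TY.
  by exists fA, h.
pose S := supported P.
pose Ri (i : 'I_#|~: S|) := P (enum_val i).
pose R := dsums [seq Ri i | i <- enum 'I_#|~: S|].
have Riinj i j : riso (Ri i) (Ri j) -> i = j.
  by move=> /Pinj; apply: enum_val_inj.
have Rp : rprojective R.
  by apply: rprojective_dsums => i; exact: (@indec_proj _ _ PA).
have mS : m = #|S|.
  have mle : (m <= #|S|)%N.
    exact: (ext_projective_rank_leq Pind PA (fun i => Find (r i)) rinj TNi Nip).
  apply/eqP; rewrite eqn_leq mle /=.
  apply: (ext_projective_rank_geq Pind Pinj PA (N := Ni)) => k.
  have [f [g [g1 gE _ fE _]]] := ZZP k; exists (ZZ k).1, (ZZ k).2, f, g; split=> //.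
  have kB : dsummand (dsum (ZZ k).1 (ZZ k).2) B.
    apply: dsummand_trans (dsummand_dsumr _ _).
    by apply: (dsummand_dsums (fun k => dsum (ZZ k).1 (ZZ k).2)); rewrite mem_enum.
  move=> X Xind H; apply: Nclass => //; apply: dsummand_trans kB.
  case: H => H; apply: dsummand_trans H _; first exact: dsummand_dsuml.
  exact: dsummand_dsumr.
exists N, R; split=> //.
  split; first by exists m, Ni; split; [move=> i; apply: Find | apply: rinj | apply: riso_refl].
  by exists #|~: S|, Ri; split; [move=> i; apply: Pind | apply: Riinj | apply: riso_refl].
split.
  split; [exact: Rp | exact: ext_projective_hom0_tau Np TN |].
  apply: (hom0_dsums _ (F := Ri)) => i.
  have : enum_val i \notin S by have := enum_valP i; rewrite in_setC.
  by move=> /unsupported_hom0/(_ TN).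
exists m, #|~: S|; split.
- by apply: (num_summands_dsums (F := Ni)) rinj (riso_refl _) => i; apply: Find.
- by apply: (num_summands_dsums (F := Ri)) Riinj (riso_refl _) => i; apply: Pind.
- by rewrite mS cardsC card_ord; apply: (num_summands_dsums (F := P)).
Qed.

End SupportTauTilting.

Theorem proposition3p4 (K : fieldType) (A : falgType K)
    (U Q M P : rmod A)
    (basicA : basic (rmod_regular A))
    (UQ_basic : basic_pair U Q) (UQ_rigid : tau_rigid_pair U Q)
    (MP_basic : basic_pair M P) (MP_tilting : tau_tilting_pair M P) :
  let W := wide_of U Q in
  (* (i) *)
  (torsion_class W (W `&` Fac M) /\
   tors U Q (star (Fac U) (W `&` Fac M))) /\
  (* (ii) *)
  (forall X, W X -> has_left_approx (rperp U `&` Fac M) X) /\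
  (* (iii) *)
  [<-> rperp U `&` Fac M `=` W `&` Fac M;
       rperp U `&` Fac M `<=` W;
       rperp U `&` Fac M `<=` lperp (tau U) `&` rperp Q;
       Fac M `<=` lperp (tau U) `&` rperp Q] /\
  (Fac M `<=` lperp (tau U) `&` rperp Q ->
   (* (iv) *)
   ((torsion_class W (W `&` Fac M) /\ functorially_finite W (W `&` Fac M)) /\
    ftors U Q (star (Fac U) (W `&` Fac M))) /\
   (* (v) *)
   (left_Bongartz_completion_exists U Q M P /\
    star (Fac U) (W `&` Fac M) `=` star (Fac U) (rperp U `&` Fac M) /\
    star (Fac U) (rperp U `&` Fac M) `=` star (Fac U) (Fac M))).
Proof.
move=> W; have [Qp Ur QU] := UQ_rigid; have [[_ Mr _] _] := MP_tilting.
split; first by split; [apply: wide_Fac_torsion | apply: star_tors].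
split; first by move=> X _; apply: rperp_Fac_left_approx.
split.
  (* The substance is in the third implication, which passes from the [U]-torsion-free quotients to
     all of [Fac M]. *)
  tfae.
  - by move=> H X /H[].
  - by move=> H X /H /wide_ofE[].
  - exact: rperp_Fac_rtop.
  - exact: rperp_Fac_wide.
move=> Mtop; have ff := star_ftors Ur Qp QU Mr Mtop.
split.
  split=> //; split; first exact: wide_Fac_torsion.
  exact: wide_Fac_ff.
split; last by split; [apply: star_wide_rperp | apply: star_rperp_Fac].
have [|N [R [NR_basic NR_tilting FacN]]] := support_tau_tilting_ex
    (star_quot Ur Qp QU) (star_ext Ur Qp QU Mr) (star0 U Q M) _ basicA.
  move=> X; case: ff => _ /(_ X I)[]; exact.
by exists N, R.
Qed.
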